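(* Let $n\ge2$. The following property holds if and only if $n$ is squarefree: any two centralizers (in $PSL(n,\mathbb{C})$) of irreducible subgroups of $PSL(n,\mathbb{C})$ that are isomorphic as abstract groups are conjugate in $PSL(n,\mathbb{C})$.
   Context: A subgroup of $SL(n,\mathbb{C})$ is irreducible if no nonzero proper subspace of $\mathbb{C}^n$ is invariant; a subgroup of $PSL(n,\mathbb{C})=SL(n,\mathbb{C})/Z(SL(n,\mathbb{C}))$ is irreducible if its preimage in $SL(n,\mathbb{C})$ is. An integer $n\ge2$ is squarefree if no square of a prime divides it. *)

(* Defs.v *)
From HB Require Import structures.
From mathcomp Require Import all_boot all_order all_algebra.
Set Implicit Arguments. Unset Strict Implicit. Unset Printing Implicit Defensive.
Import GRing.Theory.
Local Open Scope ring_scope.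

(* Subgroups of PSL(n,F) = SL(n,F)/Z are represented by their full preimages
   in SL(n,F), i.e. subgroups of SL(n,F) containing the centre Z.
   Sets of matrices are Prop-valued predicates (groups may be infinite). *)

Section PSL.
Variables (F : fieldType) (n : nat).
Local Notation M := 'M[F]_n.

Definition SL (A : M) : Prop := \det A = 1.

Definition centreSL (A : M) : Prop := exists z : F, A = z%:M /\ \det A = 1.

Definition subgroupSL (H : M -> Prop) : Prop :=
  [/\ H 1%:M,
      (forall A, H A -> SL A),
      (forall A B, H A -> H B -> H (A *m B)) &
      (forall A, H A -> H (invmx A))].

Definition subgroupPSL (H : M -> Prop) : Prop :=
  subgroupSL H /\ (forall A, centreSL A -> H A).

(* irreducible: no nonzero proper subspace of F^n is invariant
   (subspaces = row spaces of matrices U, acting on row vectors) *)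
Definition irreducibleSL (H : M -> Prop) : Prop :=
  forall U : M, (forall A, H A -> (U *m A <= U)%MS) ->
    U = 0 \/ row_full U.

(* preimage in SL of the centraliser in PSL of the image of H *)
Definition centPSL (H : M -> Prop) (g : M) : Prop :=
  SL g /\ (forall h, H h -> centreSL (g *m h *m invmx (h *m g))).

Definition modZ (A B : M) : Prop := centreSL (A *m invmx B).

(* images of C1 and C2 in PSL are isomorphic as abstract groups:
   a map f inducing a group isomorphism C1/Z -> C2/Z *)
Definition isoPSL (C1 C2 : M -> Prop) : Prop :=
  exists f : M -> M,
  [/\ (forall x, C1 x -> C2 (f x)),
      (forall x y, C1 x -> C1 y -> modZ x y -> modZ (f x) (f y)),
      (forall x y, C1 x -> C1 y -> modZ (f (x *m y)) (f x *m f y)),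
      (forall x y, C1 x -> C1 y -> modZ (f x) (f y) -> modZ x y) &
      (forall y, C2 y -> exists2 x, C1 x & modZ (f x) y)].

(* images of C1 and C2 are conjugate in PSL (both are full preimages) *)
Definition conjPSL (C1 C2 : M -> Prop) : Prop :=
  exists2 g, SL g & forall x, C2 x <-> C1 (invmx g *m x *m g).

End PSL.

Definition squarefree (n : nat) : Prop :=
  forall p, prime p -> ~~ (p * p %| n)%N.

(* Main.v *)
Require Import Defs.
From HB Require Import structures.
From mathcomp Require Import all_boot all_order all_algebra.
From mathcomp Require Import all_fingroup all_solvable all_field.
From mathcomp Require Import ring zify.
From Stdlib Require Import Setoid Morphisms Classical.
Set Implicit Arguments. Unset Strict Implicit. Unset Printing Implicit Defensive.
Import GRing.Theory.
Local Open Scope ring_scope.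

(* Let C be the centralizer of the irreducible group H, and Z the scalars.  By Schur's
   lemma a nonscalar x in C has trace 0 (it is conjugate under H to a nontrivial multiple
   of itself), x^n is scalar, and C/Z is abelian; commutators define a scalar-valued
   pairing on it.  If x, y in C commute, have order p and are independent modulo Z, the
   idempotent p^-2 * sum_(i,j < p) x^i y^j has trace n / p^2, so p^2 divides n.  Hence for
   squarefree n every p-part of C/Z is trivial, Z/p, or (Z/p)^2 with nondegenerate
   pairing; gluing over the primes, C is generated modulo Z by u, v with u^d1 = v^d2 = 1
   and uv = w vu, where w has order d2 | d1 | n.  The abstract group C/Z determines d1 and
   d2, and all proper powers of u being traceless, the spectral idempotents of u yield an
   intertwiner between any two such pairs.

   If p^2 | n, write F^n as the tensor product of F^p, F^p and F^k.  The clock and shift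
   matrices of the first factor, respectively the clock matrices of the first two factors,
   generate modulo Z two copies of (Z/p)^2, of which only the second lifts to a commutative
   group.  Each is the centralizer of its own centralizer, which is irreducible. *)

(** * Roots and roots of unity in a closed field *)

Section ClosedFields.
Variable F : closedFieldType.

Lemma closed_nth_root (a : F) k : (0 < k)%N -> exists x, x ^+ k = a.
Proof.
(* The coefficient sequence [nth 0 [:: a]] is a, 0, 0, ..., so the monic equation that is solved
   reads x^k = a. *)
move=> k0; have [x ex] := @solve_monicpoly F k (nth 0 [:: a]) k0.
exists x; rewrite {}ex; case: k k0 => // k _; rewrite big_ord_recl /= expr0 mulr1 big1 ?addr0 //.
by move=> i _; rewrite /= nth_nil mul0r.
Qed.

(** In characteristic 0 the polynomial X^k - 1 is separable and so has k distinct roots; k distinct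
    k-th roots of unity in a field include a primitive one. *)
Lemma exists_primitive_root (charF0 : [pchar F] =i pred0) k :
  (0 < k)%N -> exists z : F, k.-primitive_root z.
Proof.
move=> k0; pose p : {poly F} := 'X^k - 1.
have [r Dp] := closed_field_poly_normal p.
rewrite (monicP _) ?monicXnsubC // scale1r in Dp.
have rn1: all k.-unity_root r by apply/allP=> z; rewrite -root_prod_XsubC -Dp.
have sz_r: (k < (size r).+1)%N by rewrite -(size_prod_XsubC r id) -Dp size_XnsubC.
have [|z _ pz] := hasP (has_prim_root k0 rn1 _ sz_r); last by exists z.
rewrite -separable_prod_XsubC -Dp separable_Xn_sub_1 //.
by rewrite ((pcharf0P F).1 charF0) -lt0n.
Qed.

End ClosedFields.

(** * Matrices up to scalars *)

Section ProjectiveEquality.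
Variables (F : fieldType) (m : nat).
Local Notation M := 'M[F]_m.+1.

(** Any nonzero scalar is allowed, not only those of determinant 1, so that matrices can be rescaled
    freely; on SL this is [modZ] (see [modZE]). The size [m.+1] makes matrices a unit ring. *)
Definition proj_eq (A B : M) : Prop := exists2 c : F, c != 0 & A = c *: B.

Lemma proj_eq_refl A : proj_eq A A.
Proof. by exists 1; rewrite ?oner_eq0 ?scale1r. Qed.

Lemma proj_eq_sym A B : proj_eq A B -> proj_eq B A.
Proof.
by case=> c c0 ->; exists c^-1; rewrite ?invr_eq0 // scalerA mulVf // scale1r.
Qed.

Lemma proj_eq_trans A B C : proj_eq A B -> proj_eq B C -> proj_eq A C.
Proof.
by case=> c c0 -> [d d0 ->]; exists (c * d); rewrite ?mulf_neq0 ?scalerA.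
Qed.

#[export] Instance proj_eq_equiv : Equivalence proj_eq.
Proof.
split; [exact: proj_eq_refl | exact: proj_eq_sym | exact: proj_eq_trans].
Qed.

#[export] Instance proj_eq_mul :
  Proper (proj_eq ==> proj_eq ==> proj_eq) (@GRing.mul M).
Proof.
move=> A A' [c c0 ->] B B' [d d0 ->]; exists (c * d); rewrite ?mulf_neq0 //.
by rewrite -scalerAl -scalerAr scalerA.
Qed.

Lemma proj_eqM A A' B B' : proj_eq A A' -> proj_eq B B' -> proj_eq (A * B) (A' * B').
Proof. by move=> hA hB; apply: (proj_eq_mul hA hB). Qed.

Lemma proj_eqX A B k : proj_eq A B -> proj_eq (A ^+ k) (B ^+ k).
Proof. by case=> c c0 ->; exists (c ^+ k); rewrite ?expf_neq0 // exprZn. Qed.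

Lemma proj_eqX1 A k : proj_eq A 1 -> proj_eq (A ^+ k) 1.
Proof. by move/(proj_eqX k); rewrite expr1n. Qed.

Lemma proj_eq1_comm A B : proj_eq A 1 -> A * B = B * A.
Proof. by case=> c _ ->; rewrite -scalerAl -scalerAr mul1r mulr1. Qed.

Lemma proj_eqZ (c : F) A : c != 0 -> proj_eq (c *: A) A.
Proof. by exists c. Qed.

Lemma scale_unit_inj (a b : F) (A : M) : A \is a GRing.unit -> a *: A = b *: A -> a = b.
Proof.
move=> uA /(congr1 (fun X => X / A)); rewrite -!scalerAl divrr //.
by move/matrixP/(_ ord0 ord0); rewrite !mxE eqxx !mulr1.
Qed.

Lemma proj_eqMl A B C : A \is a GRing.unit ->
  proj_eq (A * B) (A * C) -> proj_eq B C.
Proof.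
move=> uA /(proj_eqM (proj_eq_refl A^-1)).
by rewrite !mulKr.
Qed.

Lemma proj_eq_inv A B : proj_eq A 1 -> proj_eq (A * B) 1 -> proj_eq B 1.
Proof.
by move=> /proj_eq_sym hA hAB; rewrite -(mul1r B); apply: proj_eq_trans hAB;
  apply: proj_eqM => //; apply: proj_eq_refl.
Qed.

Lemma proj_eqX_gcd A a b : A \is a GRing.unit ->
  proj_eq (A ^+ a) 1 -> proj_eq (A ^+ b) 1 -> proj_eq (A ^+ gcdn a b) 1.
Proof.
move=> uA ha hb; case: (posnP a) => [a0|a0]; first by rewrite a0 gcd0n.
(* Bezout over the naturals, [k * a = l * b + gcdn a b], requires a > 0. *)
case: (egcdnP b a0) => k l e _.
have := proj_eqX1 k ha; rewrite -exprM mulnC e exprD mulnC exprM.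
exact/proj_eq_inv/proj_eqX1.
Qed.

Lemma proj_eqX_coprime A a b : A \is a GRing.unit -> coprime a b ->
  proj_eq (A ^+ a) 1 -> proj_eq (A ^+ b) 1 -> proj_eq A 1.
Proof. by move=> uA /eqP cab ha /(proj_eqX_gcd uA ha); rewrite cab expr1. Qed.

Lemma proj_eqX_mod A d a b : A \is a GRing.unit -> proj_eq (A ^+ d) 1 ->
  a = b %[mod d] -> proj_eq (A ^+ a) (A ^+ b).
Proof.
move=> uA hd e; rewrite (divn_eq a d) (divn_eq b d) !exprD e.
apply: proj_eqM; last exact: proj_eq_refl.
rewrite ![(_ * d)%N]mulnC !exprM; apply: proj_eq_trans (proj_eqX1 _ hd) _.
exact/proj_eq_sym/proj_eqX1.
Qed.

Lemma proj_eqX_dvd A d a : A \is a GRing.unit -> proj_eq (A ^+ d) 1 ->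
  (d %| a)%N -> proj_eq (A ^+ a) 1.
Proof. by move=> uA hd /dvdnP[k ->]; rewrite mulnC exprM; apply: proj_eqX1. Qed.

Lemma proj_eqX_prime A p k : A \is a GRing.unit -> prime p ->
  ~ proj_eq A 1 -> proj_eq (A ^+ p) 1 -> proj_eq (A ^+ k) 1 -> (p %| k)%N.
Proof.
move=> uA pp nA hp hk; apply/negPn/negP => pk; apply: nA.
by apply: proj_eqX_coprime hp hk => //; rewrite prime_coprime.
Qed.

(** Each of the i factors [A] passes each of the j factors [B] at the cost of one factor w. *)
Lemma weyl_expr (w : F) (A B : M) i j :
  A * B = w *: (B * A) -> A ^+ i * B ^+ j = w ^+ (i * j) *: (B ^+ j * A ^+ i).
Proof.
move=> h.
have h1 k : A ^+ k * B = w ^+ k *: (B * A ^+ k).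
  elim: k => [|k IH]; first by rewrite !expr0 mul1r mulr1 scale1r.
  rewrite [A ^+ _]exprS [w ^+ _]exprSr -mulrA IH -scalerAr.
  by rewrite [A * (B * _)]mulrA h -scalerAl scalerA [X in _ = _ *: X]mulrA.
elim: j => [|j IH]; first by rewrite muln0 !expr0 mul1r mulr1 scale1r.
rewrite ![B ^+ _.+1]exprSr mulrA IH -scalerAl -[X in _ *: X = _]mulrA h1.
by rewrite -scalerAr scalerA -exprD mulnS addnC [X in _ *: X = _]mulrA.
Qed.

Lemma det_unit (A : M) : \det A = 1 -> A \is a GRing.unit.
Proof. by move=> dA; rewrite -[_ \is a _]/(A \in unitmx) unitmxE dA unitr1. Qed.

Lemma mul_unit (A B : M) :
  A \is a GRing.unit -> B \is a GRing.unit -> A * B \is a GRing.unit.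
Proof. by move=> uA uB; rewrite (unitrMl _ uB). Qed.

Lemma comm_inv_scale (c : F) (X A : M) : X \is a GRing.unit ->
  X * A = c *: (A * X) -> A * X^-1 = c *: (X^-1 * A).
Proof.
move=> uX e; apply: (mulrI uX).
by rewrite mulrA e -scalerAl mulrK // -scalerAr mulVKr.
Qed.

End ProjectiveEquality.

(** * Centralizers of irreducible groups *)

Section Schur.
Variables (F : closedFieldType) (m : nat).
Local Notation M := 'M[F]_m.+1.

(** Scaling by c multiplies the determinant by c^(m+1), so c is an (m+1)-th root of its inverse. *)
Lemma scale_to_det1 (A : M) : A \is a GRing.unit ->
  exists2 c : F, c != 0 & \det (c *: A) = 1.
Proof.
move=> uA; have dA : \det A != 0 by rewrite -unitfE -unitmxE.
have [c ec] := @closed_nth_root F (\det A)^-1 m.+1 isT.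
exists c; last by rewrite detZ ec mulVf.
by apply: contraNneq dA => c0; move: ec; rewrite c0 expr0n /= => /eqP;
  rewrite eq_sym invr_eq0.
Qed.

Lemma exists_eigenvalue (A : M) : exists a, eigenvalue A a.
Proof.
have /(PreClosedField.closed_rootP (@solve_monicpoly F)) [a ra] :
  size (char_poly A) != 1 by rewrite size_char_poly.
by exists a; rewrite eigenvalue_root_char.
Qed.

(** An eigenspace of g is nonzero and stable under everything that commutes with g, hence it is the
    whole space. *)
Lemma schur (P : M -> Prop) (g : M) : irreducibleSL P ->
  (forall A, P A -> g * A = A * g) -> exists c, g = c%:M.
Proof.
move=> irrP cg; have [a ea] := exists_eigenvalue g; exists a.
have [|e0|/row_fullP[B eB]] := irrP (eigenspace g a).
- move=> A PA; apply/eigenspaceP; rewrite -mulmxA -[A *m g]/(A * g) -cg //.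
  rewrite [g * A]/(g *m A) mulmxA.
  by have /eigenspaceP -> := submx_refl (eigenspace g a); rewrite scalemxAl.
- by move: ea; rewrite /eigenvalue e0 eqxx.
- have : (1%:M <= eigenspace g a)%MS by rewrite -eB submxMl.
  by move/eigenspaceP; rewrite mul1mx scalemx1.
Qed.

Lemma schur_unit (P : M -> Prop) (g : M) : irreducibleSL P ->
  g \is a GRing.unit -> (forall A, P A -> g * A = A * g) -> proj_eq g 1.
Proof.
move=> irrP ug /(schur irrP)[c ec]; exists c; last by rewrite ec -scalemx1.
apply: contraTneq ug => c0; rewrite ec c0 raddf0.
by rewrite unitr0.
Qed.

(** The determinant condition in [centreSL] takes care of itself: g A and A g have equal
    determinants, and a scalar matrix of determinant 1 comes from a nonzero scalar. *)
Lemma centPSLP (P : M -> Prop) g : (forall A, P A -> A \is a GRing.unit) ->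
  centPSL P g <-> \det g = 1 /\ forall A, P A -> proj_eq (g * A) (A * g).
Proof.
move=> uP; split=> -[dg cg]; split=> // A PA; have ug := det_unit dg.
- have [z [e d]] := cg A PA.
  have uAg : A * g \is a GRing.unit by apply: mul_unit => //; apply: uP.
  exists z.
    apply: contra_eq_neq d => z0; rewrite e z0 raddf0 det0.
    by rewrite eq_sym oner_eq0.
  rewrite -(divrK uAg (g * A)) -mul_scalar_mx -e.
  by [].
- have [c c0 e] := cg A PA.
  have uAg : A * g \is a GRing.unit by apply: mul_unit => //; apply: uP.
  exists c; split.
    by rewrite -[LHS]/((g * A) / (A * g)) e -scalerAl divrr // scalemx1.
  rewrite -[X in \det X]/((g * A) / (A * g)) det_mulmx det_inv !det_mulmx.
  by rewrite [\det A * _]mulrC divrr // unitrM -!unitmxE ug uP.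
Qed.

Lemma modZE (A B : M) : \det A = 1 -> \det B = 1 -> modZ A B <-> proj_eq A B.
Proof.
move=> dA dB; have uB := det_unit dB; split.
  move=> [z [e d]]; exists z.
    apply: contra_eq_neq d => z0; rewrite e z0 raddf0 det0.
    by rewrite eq_sym oner_eq0.
  by rewrite -(divrK uB A) -mul_scalar_mx -e.
move=> [c c0 e]; exists c; rewrite -[A *m _]/(A / B); split.
  by rewrite e -scalerAl divrr // scalemx1.
by rewrite det_mulmx det_inv dA dB divr1.
Qed.

End Schur.

Section IrreducibleCentralizer.
Variables (F : closedFieldType) (m : nat).
Local Notation M := 'M[F]_m.+1.
Variable H : M -> Prop.
Hypothesis subH : forall A, H A -> \det A = 1.
Hypothesis irrH : irreducibleSL H.

Let uH A : H A -> A \is a GRing.unit.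
Proof. by move/subH/det_unit. Qed.

Lemma cent_det g : centPSL H g -> \det g = 1.
Proof. by case. Qed.

Lemma cent_unit g : centPSL H g -> g \is a GRing.unit.
Proof. by move/cent_det/det_unit. Qed.

Lemma cent_one : centPSL H 1.
Proof.
apply/(centPSLP _ uH); split; first exact: det1.
by move=> A _; rewrite mul1r mulr1; apply: proj_eq_refl.
Qed.

Lemma cent_mul x y : centPSL H x -> centPSL H y -> centPSL H (x * y).
Proof.
move=> /(centPSLP _ uH)[dx cx] /(centPSLP _ uH)[dy cy].
apply/(centPSLP _ uH); split; first by rewrite det_mulmx dx dy mulr1.
by move=> A HA; rewrite -mulrA (cy A HA) !mulrA (cx A HA); reflexivity.
Qed.

Lemma cent_pow x k : centPSL H x -> centPSL H (x ^+ k).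
Proof.
move=> cx; elim: k => [|k IH]; first by rewrite expr0; apply: cent_one.
by rewrite exprS; apply: cent_mul.
Qed.

Lemma cent_proj g x : centPSL H x -> \det g = 1 -> proj_eq g x -> centPSL H g.
Proof.
move=> /(centPSLP _ uH)[dx cx] dg e.
apply/(centPSLP _ uH); split=> // A HA.
by rewrite e; apply: cx.
Qed.

(* the commutator of two elements of the centralizer acts trivially on [H] by conjugation *)
Lemma cent_comm x y : centPSL H x -> centPSL H y -> proj_eq (x * y) (y * x).
Proof.
move=> Cx Cy; have [ux uy] := (cent_unit Cx, cent_unit Cy).
have uyx : y * x \is a GRing.unit by rewrite mul_unit.
suff h : proj_eq ((y * x)^-1 * (x * y)) 1.
  by rewrite -[x * y](mulVKr uyx) h mulr1; reflexivity.
apply: (schur_unit irrH) => [|A HA].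
  by rewrite mul_unit ?unitrV // mul_unit.
have [/(centPSLP _ uH)[_ /(_ A HA)] [a a0 ea] /(centPSLP _ uH)[_ /(_ A HA)][b b0 eb]]
  := (Cx, Cy).
have exy : x * y * A = (a * b) *: (A * (x * y)).
  by rewrite -mulrA eb -scalerAr mulrA ea -scalerAl scalerA mulrC mulrA.
have eyx : y * x * A = (a * b) *: (A * (y * x)).
  by rewrite -mulrA ea -scalerAr mulrA eb -scalerAl scalerA mulrA.
by rewrite [RHS]mulrA (comm_inv_scale uyx eyx) -[LHS]mulrA exy -scalerAr -scalerAl mulrA.
Qed.

(** If [x A = c A x], then x and its conjugate c^-1 x have the same trace. A nonzero trace thus
    forces c = 1 for every A in H, and x is scalar by Schur's lemma. *)
Lemma cent_tr x : centPSL H x -> ~ proj_eq x 1 -> \tr x = 0.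
Proof.
move=> Cx nx; have ux := cent_unit Cx.
apply: NNPP => t0; apply: nx; apply: (schur_unit irrH) => // A HA.
have [c c0 e] := ((centPSLP _ uH).1 Cx).2 A HA.
suff c1 : c = 1 by rewrite e c1 scale1r.
apply: (mulIf (introN eqP t0)); rewrite mul1r.
have uA := uH HA.
rewrite -mxtraceZ -[in RHS](mulrK uA x) e -scalerAl !mxtraceZ; congr (_ * _).
rewrite -[in RHS]mulrA -[X in _ = \tr X]/(A *m (x / A)) mxtrace_mulC.
by rewrite -[X in _ = \tr X]/((x / A) * A) divrK.
Qed.

(** Determinants in [x A = c A x] give c^(m+1) = 1, so x^(m+1) commutes with H and Schur's lemma
    applies. *)
Lemma cent_exp x : centPSL H x -> proj_eq (x ^+ m.+1) 1.
Proof.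
move=> Cx; have ux := cent_unit Cx.
apply: (schur_unit irrH); first exact: unitrX.
move=> A HA; have [c c0 e] := ((centPSLP _ uH).1 Cx).2 A HA.
have := weyl_expr m.+1 1 e; rewrite muln1 !expr1 => ->.
suff -> : c ^+ m.+1 = 1 by rewrite scale1r.
have := congr1 determinant e; rewrite detZ !det_mulmx (cent_det Cx) (subH HA).
by rewrite !mulr1 => <-.
Qed.

End IrreducibleCentralizer.

(** * Idempotents and spectral projectors of matrices of finite order *)

Section CyclicProjectors.
Variables (F : fieldType) (m : nat).
Hypothesis charF0 : [pchar F] =i pred0.
Local Notation M := 'M[F]_m.+1.

Lemma natr_neq0 k : (0 < k)%N -> k%:R != 0 :> F.
Proof. by rewrite ((pcharf0P F).1 charF0) lt0n. Qed.

Lemma natr_inj_char0 i j : i%:R = j%:R :> F -> i = j.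
Proof.
wlog le_ij : i j / (i <= j)%N.
  by move=> W e; case/orP: (leq_total i j) => l; [|symmetry]; apply: W.
move=> e; apply/eqP; rewrite eqn_leq le_ij /= -subn_eq0.
by rewrite -((pcharf0P F).1 charF0) natrB // e subrr.
Qed.

(** In the full-rank factorization E = C R, the relation C R C R = C R can be cancelled on both
    sides. *)
Lemma idem_factor (E : M) : E * E = E ->
  exists C : 'M[F]_(m.+1, \rank E), exists2 R : 'M[F]_(\rank E, m.+1),
    E = C *m R & R *m C = 1%:M.
Proof.
move=> idE; exists (col_base E), (row_base E); first by rewrite mulmx_base.
have h : col_base E *m (row_base E *m col_base E) *m row_base E
       = col_base E *m 1%:M *m row_base E.
  rewrite mulmx1 mulmx_base -[RHS]idE -[in RHS](mulmx_base E).
  by rewrite -[RHS]/(_ *m _) !mulmxA.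
apply: (row_full_inj (col_base_full E)); apply: (row_free_inj (row_base_free E)).
exact: h.
Qed.

Lemma idem_tr (E : M) : E * E = E -> \tr E = (\rank E)%:R.
Proof.
by case/idem_factor=> C [R eE RC]; rewrite {1}eE mxtrace_mulC RC mxtrace1.
Qed.

(** When x^d = 1 this is the projector onto the fixed vectors of x. Applied to a multiple [b *: x]
    with b^d = 1, it projects onto the eigenspace of x for b^-1. *)
Definition cyc_proj d (x : M) : M := d%:R^-1 *: \sum_(0 <= k < d) x ^+ k.

Lemma cyc_projM d x : (0 < d)%N -> x ^+ d = 1 -> x * cyc_proj d x = cyc_proj d x.
Proof.
move=> d0 xd; rewrite /cyc_proj -scalerAr mulr_sumr; congr (_ *: _).
under eq_bigr do rewrite -exprS.
case: d d0 xd => // d _ xd; rewrite big_nat_recr //= xd.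
by rewrite [RHS]big_nat_recl // expr0 addrC.
Qed.

Lemma cyc_projXM d x k : (0 < d)%N -> x ^+ d = 1 ->
  x ^+ k * cyc_proj d x = cyc_proj d x.
Proof.
move=> d0 xd; elim: k => [|k IH]; first by rewrite expr0 mul1r.
by rewrite exprSr -mulrA cyc_projM.
Qed.

Lemma cyc_proj_comm d x y : x * y = y * x -> cyc_proj d x * y = y * cyc_proj d x.
Proof.
move=> xy; rewrite /cyc_proj -scalerAl -scalerAr mulr_sumr mulr_suml.
by congr (_ *: _); apply: eq_bigr => k _; apply/esym/commrX.
Qed.

Lemma cyc_proj_idem d x : (0 < d)%N -> x ^+ d = 1 ->
  cyc_proj d x * cyc_proj d x = cyc_proj d x.
Proof.
move=> d0 xd; rewrite {1}/cyc_proj -scalerAl mulr_suml.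
rewrite (eq_bigr (fun=> cyc_proj d x)) => [|k _]; last exact: cyc_projXM.
rewrite sumr_const_nat subn0 -scaler_nat scalerA mulVf ?natr_neq0 //.
by rewrite scale1r.
Qed.

(** The second projector absorbs [b *: x] and the first absorbs x, so the product equals b times
    itself. *)
Lemma cyc_proj_orth d x (b : F) : (0 < d)%N -> x ^+ d = 1 -> b ^+ d = 1 ->
  b != 1 -> cyc_proj d x * cyc_proj d (b *: x) = 0.
Proof.
move=> d0 xd bd b1; set y := b *: x; have yd : y ^+ d = 1 by rewrite exprZn xd bd scale1r.
have h : cyc_proj d x * cyc_proj d y = b *: (cyc_proj d x * cyc_proj d y).
  have e : cyc_proj d y = b *: (x * cyc_proj d y).
    by rewrite -{1}(cyc_projM d0 yd) {1}/y scalerAl.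
  by rewrite {1}e -scalerAr mulrA (cyc_proj_comm d (erefl (x * x))) cyc_projM.
move/eqP: h; rewrite -subr_eq0 -[X in X - _]scale1r -scalerBl scaler_eq0 subr_eq0.
by rewrite eq_sym (negPf b1) => /eqP.
Qed.

Lemma sum_prim_root d (z : F) k : d.-primitive_root z -> (k < d)%N ->
  \sum_(0 <= i < d) (z ^+ i) ^+ k = if k == 0%N then d%:R else 0.
Proof.
move=> pz kd; case: eqP => [->|/eqP k0].
  by under eq_bigr do rewrite expr0; rewrite sumr_const_nat subn0.
have d0 := prim_order_gt0 pz.
have zk1 : z ^+ k != 1.
  by rewrite -(prim_order_dvd pz) gtnNdvd // lt0n.
have : (z ^+ k - 1) * \sum_(0 <= i < d) (z ^+ i) ^+ k = 0.
  rewrite (eq_bigr (fun i => (z ^+ k) ^+ i)); last first.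
    by move=> i _; rewrite -!exprM mulnC.
  by rewrite big_mkord -subrX1 -exprM mulnC exprM (prim_expr_order pz) expr1n subrr.
by move/eqP; rewrite mulf_eq0 subr_eq0 (negPf zk1) => /eqP.
Qed.

(** In the sum over i the coefficient of x^k is a sum of powers of z^k, which vanishes unless k = 0:
    the spectral projectors add up to the identity. *)
Lemma cyc_proj_sum d z x : d.-primitive_root z ->
  \sum_(0 <= i < d) cyc_proj d (z ^+ i *: x) = 1.
Proof.
move=> pz; have d0 := prim_order_gt0 pz.
rewrite -scaler_sumr exchange_big_nat /=.
rewrite (eq_big_nat _ _ (F2 := fun k => if k == 0%N then d%:R *: 1 else 0)); last first.
  move=> k /andP[_ kd]; under eq_bigr do rewrite exprZn.
  rewrite -scaler_suml (sum_prim_root pz kd).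
  by case: eqP => [->|_]; rewrite ?expr0 ?scale0r.
rewrite big_ltn //= [X in _ + X]big_nat big1 ?addr0; last first.
  by move=> i /andP[i0 _]; case: eqP i0 => // ->.
by rewrite scalerA mulVf ?natr_neq0 // scale1r.
Qed.

Lemma cyc_proj_tr d x : (0 < d)%N ->
  (forall k, (0 < k < d)%N -> \tr (x ^+ k) = 0) ->
  \tr (cyc_proj d x) = d%:R^-1 * m.+1%:R.
Proof.
move=> d0 tr0; rewrite mxtraceZ raddf_sum /= big_ltn // expr0 mxtrace1.
by rewrite big_nat big1 ?addr0.
Qed.

End CyclicProjectors.

(** * Commuting independent pairs force a square divisor *)

Section IndependentPair.
Variables (F : closedFieldType) (m : nat).
Hypothesis charF0 : [pchar F] =i pred0.
Local Notation M := 'M[F]_m.+1.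

Lemma proj_expr1_normalize (x : M) p : (0 < p)%N -> proj_eq (x ^+ p) 1 ->
  exists2 y, proj_eq y x & y ^+ p = 1.
Proof.
move=> p0 [c c0 e]; have [b eb] := closed_nth_root c^-1 p0.
exists (b *: x); last by rewrite exprZn eb e scalerA mulVf // scale1r.
apply: proj_eqZ; apply: contraNneq c0 => b0.
by rewrite -invr_eq0 -eb b0 expr0n; case: p p0 {e eb}.
Qed.

(** After normalization to x^p = y^p = 1, the product of the two commuting projectors is idempotent.
    Its trace is its rank r, and only the term i = j = 0 contributes, so r p^2 = m+1. *)
Lemma commuting_pair_square_dvd (x y : M) p : (0 < p)%N -> x * y = y * x ->
  proj_eq (x ^+ p) 1 -> proj_eq (y ^+ p) 1 ->
  (forall i j, (i < p)%N -> (j < p)%N -> (0 < i + j)%N -> \tr (x ^+ i * y ^+ j) = 0) ->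
  (p * p %| m.+1)%N.
Proof.
move=> p0 xy /(proj_expr1_normalize p0)[x' [a a0 ex] xp].
move=> /(proj_expr1_normalize p0)[y' [b b0 ey] yp] tr0.
have xy' : x' * y' = y' * x'.
  by rewrite ex ey -!scalerAl -!scalerAr xy !scalerA mulrC.
have tr0' i j : (i < p)%N -> (j < p)%N -> (0 < i + j)%N -> \tr (x' ^+ i * y' ^+ j) = 0.
  move=> ip jp ij; rewrite ex ey !exprZn -scalerAl -scalerAr !mxtraceZ tr0 //.
  by rewrite !mulr0.
pose E := cyc_proj p x' * cyc_proj p y'.
have cE : cyc_proj p x' * cyc_proj p y' = cyc_proj p y' * cyc_proj p x'.
  by apply: cyc_proj_comm; apply/esym/cyc_proj_comm.
have idE : E * E = E.
  rewrite /E {2}cE mulrA -[_ * _ * cyc_proj p y']mulrA cyc_proj_idem //.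
  by rewrite -mulrA -cE mulrA cyc_proj_idem.
have := idem_tr idE; set r := \rank E.
rewrite /E /cyc_proj -scalerAl -scalerAr !mxtraceZ mulr_suml raddf_sum /=.
rewrite big_ltn // expr0 mul1r raddf_sum /= big_ltn // expr0 mxtrace1.
rewrite big_nat big1 ?addr0; last first.
  by move=> j /andP[j0 jp]; rewrite -(mul1r (y' ^+ j)) -(expr0 x') tr0'.
rewrite big_nat big1 ?addr0; last first.
  move=> i /andP[i0 ip]; rewrite mulr_sumr raddf_sum /= big_nat big1 // => j /andP[_ jp].
  by rewrite tr0' // ltn_addr.
move=> e; apply/dvdnP; exists r; apply: (natr_inj_char0 charF0).
rewrite !natrM -e; have p1 := natr_neq0 charF0 p0.
by field.
Qed.

End IndependentPair.

(** * Structure of the centralizer in squarefree degree *)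

Lemma primitive_root_intro (F : fieldType) (w : F) d : (0 < d)%N -> w ^+ d = 1 ->
  (forall k, w ^+ k = 1 -> (d %| k)%N) -> d.-primitive_root w.
Proof.
move=> d0 wd h; apply/andP; split=> //; apply/forallP=> i; rewrite unity_rootE.
apply/eqP; apply/eqP/eqP => [/h /(dvdn_leq (ltn0Sn _)) di|-> //].
by apply/eqP; rewrite eqn_leq di ltn_ord.
Qed.

Lemma prime_inverse p j : prime p -> ~~ (p %| j)%N -> exists k l, (k * j = l * p + 1)%N.
Proof.
move=> pp pj; have j0 : (0 < j)%N by case: j pj; rewrite ?dvdn0.
case: (egcdnP p j0) => k l e _; exists k, l; rewrite e.
by move: pj; rewrite -prime_coprime // coprime_sym => /eqP ->.
Qed.

Section Structure.
Variables (F : closedFieldType) (m : nat).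
Hypothesis charF0 : [pchar F] =i pred0.
Local Notation M := 'M[F]_m.+1.
Variable H : M -> Prop.
Hypothesis subH : forall A, H A -> \det A = 1.
Hypothesis irrH : irreducibleSL H.
Local Notation C := (centPSL H).

Let Cu x : C x -> x \is a GRing.unit := @cent_unit _ _ H x.
Let CM x y : C x -> C y -> C (x * y) := @cent_mul _ _ H subH x y.
Let CX x k : C x -> C (x ^+ k) := @cent_pow _ _ H subH x k.

Lemma cent_commX x y i j : C x -> C y -> proj_eq (x ^+ i * y ^+ j) (y ^+ j * x ^+ i).
Proof. by move=> Cx Cy; apply: (cent_comm subH irrH); apply: CX. Qed.

Lemma cent_exprM x y k : C x -> C y -> proj_eq ((x * y) ^+ k) (x ^+ k * y ^+ k).
Proof.
move=> Cx Cy; elim: k => [|k IH]; first by rewrite !expr0 mulr1; reflexivity.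
rewrite exprS IH mulrA -[x * y * _]mulrA -[X in x * (X * _)]expr1 cent_commX //.
by rewrite expr1 !mulrA -exprS -mulrA -exprS; reflexivity.
Qed.

Lemma cent_weyl x y : C x -> C y -> exists2 w, w != 0 & x * y = w *: (y * x).
Proof. by move=> Cx Cy; have [w w0 e] := cent_comm subH irrH Cx Cy; exists w. Qed.

(** Since x^d is scalar, it commutes with y, whereas [weyl_expr] moves it past y at the cost of
    w^d. *)
Lemma weyl_unity x y w d : C x -> C y -> x * y = w *: (y * x) ->
  proj_eq (x ^+ d) 1 -> w ^+ d = 1.
Proof.
move=> Cx Cy e xd; have := weyl_expr d 1 e; rewrite muln1 !expr1 => e1.
have uyx : y * x ^+ d \is a GRing.unit by rewrite mul_unit ?unitrX ?Cu.
by apply: (scale_unit_inj uyx); rewrite -e1 scale1r proj_eq1_comm.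
Qed.

Lemma weyl_unity_r x y w d : C x -> C y -> x * y = w *: (y * x) ->
  proj_eq (y ^+ d) 1 -> w ^+ d = 1.
Proof.
move=> Cx Cy e yd; have := weyl_expr 1 d e; rewrite mul1n !expr1 => e1.
have uyx : y ^+ d * x \is a GRing.unit by rewrite mul_unit ?unitrX ?Cu.
apply: (scale_unit_inj uyx); rewrite -e1 scale1r.
exact/esym/proj_eq1_comm.
Qed.

(** Were all nontrivial products x^i y^j with exponents below p nonscalar, they would be traceless
    and p^2 would divide the degree. So some such product is scalar; p does not divide j, since x
    itself has order p modulo scalars, and j can be inverted modulo p. *)
Lemma commuting_dependent x y p : prime p -> ~~ (p * p %| m.+1)%N ->
  C x -> C y -> x * y = y * x -> ~ proj_eq x 1 ->
  proj_eq (x ^+ p) 1 -> proj_eq (y ^+ p) 1 -> exists k, proj_eq y (x ^+ k).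
Proof.
move=> pp sqf Cx Cy xy nx xp yp; have [ux uy] := (Cu Cx, Cu Cy).
have [[i [j [ip jp ij e]]]|no] := classic (exists i j,
  [/\ (i < p)%N, (j < p)%N, (0 < i + j)%N & proj_eq (x ^+ i * y ^+ j) 1]); last first.
  case/negP: sqf; apply: (commuting_pair_square_dvd charF0 (prime_gt0 pp) xy) => //.
  move=> i j ip jp ij; apply: (cent_tr subH irrH); first by apply: CM; apply: CX.
  by move=> e; apply: no; exists i, j.
have pj : ~~ (p %| j)%N.
  case: (posnP j) => [j0|j0]; last by rewrite gtnNdvd.
  move: e ij; rewrite j0 expr0 mulr1 addn0 => /(proj_eqX_prime ux pp nx xp) pi i0.
  by move: pi; rewrite gtnNdvd.
have [k [l ekl]] := prime_inverse pp pj.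
(* Here y^j is x^(p-i) up to a scalar, and k inverts j modulo p. *)
exists ((p - i) * k)%N.
have yj : proj_eq (y ^+ j) (x ^+ (p - i)).
  apply: (proj_eqMl (unitrX i ux)); rewrite e -exprD subnKC ?xp; last exact: ltnW.
  by reflexivity.
rewrite exprM -(proj_eqX k yj) -exprM mulnC ekl exprD expr1 mulnC exprM.
by rewrite (proj_eqX1 _ yp) mul1r; reflexivity.
Qed.

(** The D-torsion of C/Z is presented as Z/d1 x Z/d2 on u and v, with w the value of the commutator
    pairing. Primitivity of w also makes the order of v exactly d2. Working relative to D allows the
    primes to be glued one at a time. *)
Record presents (D d1 d2 : nat) (u v : M) : Prop := Presents {
  pr_d1 : (d1 %| D)%N;
  pr_d2 : (d2 %| d1)%N;
  pr_Cu : C u;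
  pr_Cv : C v;
  pr_u : proj_eq (u ^+ d1) 1;
  pr_v : proj_eq (v ^+ d2) 1;
  pr_ord : forall i, proj_eq (u ^+ i) 1 -> (d1 %| i)%N;
  pr_w : exists2 w, u * v = w *: (v * u) & d2.-primitive_root w;
  pr_gen : forall x, C x -> proj_eq (x ^+ D) 1 ->
    exists i j, proj_eq x (u ^+ i * v ^+ j)
}.

Lemma presents1 D : (forall x, C x -> proj_eq (x ^+ D) 1 -> proj_eq x 1) ->
  presents D 1 1 1 1.
Proof.
have C1 := cent_one subH.
move=> h; split=> //; try by rewrite expr1n; reflexivity.
- exists 1; first by rewrite scale1r.
  by apply: primitive_root_intro => // k _; rewrite dvd1n.
- by move=> x Cx xD; exists 0%N, 0%N; rewrite !expr0 mulr1; apply: h.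
Qed.

(** Three cases: no p-torsion; a p-torsion element x commuting with all p-torsion, which is then
    cyclic on x; or a noncommuting pair x, y, whose pairing value is a primitive p-th root of
    unity. *)
Lemma presents_prime p : prime p -> ~~ (p * p %| m.+1)%N ->
  exists d1 d2 u v, presents p d1 d2 u v.
Proof.
move=> pp sqf.
have [[x [Cx nx xp]]|no] := classic (exists x, [/\ C x, ~ proj_eq x 1 & proj_eq (x ^+ p) 1]);
  last first.
  exists 1%N, 1%N, 1, 1; apply: presents1 => x Cx xp; apply: NNPP => nx.
  by apply: no; exists x.
have ux := Cu Cx.
have [[y [Cy yp xy]]|com] := classic (exists y, [/\ C y, proj_eq (y ^+ p) 1 & x * y <> y * x]);
  last first.
  exists p, 1%N, x, 1; split=> //.
  - exact: cent_one.
  - by rewrite expr1n; reflexivity.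
  - by move=> i; apply: proj_eqX_prime.
  - exists 1; first by rewrite scale1r mul1r mulr1.
    by apply: primitive_root_intro => // k _; rewrite dvd1n.
  - move=> y Cy yp; have [|k ek] := @commuting_dependent x y p pp sqf Cx Cy _ nx xp yp.
      by apply: NNPP => xy; apply: com; exists y.
    by exists k, 0%N; rewrite expr0 mulr1.
have uy := Cu Cy.
have [w w0 e] := cent_weyl Cx Cy.
have wp : w ^+ p = 1 := weyl_unity Cx Cy e xp.
have w1 : w != 1 by apply: contra_not_neq xy => w1; rewrite e w1 scale1r.
have pw : p.-primitive_root w.
  have [d pd dp] := prim_order_exists (prime_gt0 pp) wp.
  case/primeP: pp => _ /(_ d dp) /orP[/eqP d1|/eqP <- //].
  by move: (prim_expr_order pd) w1; rewrite d1 expr1 => ->; rewrite eqxx.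
exists p, p, x, y; split=> //.
- by move=> i; apply: proj_eqX_prime.
- by exists w.
- move=> z Cz zp.
  have [a a0 ea] := cent_weyl Cx Cz; have [b b0 eb] := cent_weyl Cy Cz.
  have ap := weyl_unity Cx Cz ea xp; have bp := weyl_unity Cy Cz eb yp.
  have [j ej] := prim_rootP pw ap.
  have [i ei] := prim_rootP pw bp.
  (* The pairing of z with x and y is w^j and w^i; multiplication by these powers of x and y cancels
     both, so t commutes with x and y. *)
  pose t := x ^+ i * y ^+ (p - j) * z.
  have Ct : C t by apply: CM => //; apply: CM; apply: CX.
  have xt : x * t = t * x.
    rewrite /t !mulrA -exprS exprSr.
    have := weyl_expr 1 (p - j) e; rewrite mul1n !expr1 => e1.
    rewrite -[x ^+ i * x * _]mulrA e1 -scalerAr -scalerAl mulrA -[_ * x * z]mulrA ea.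
    rewrite -scalerAr scalerA ej -exprD subnK ?(ltnW (ltn_ord j)) // wp scale1r.
    by rewrite mulrA.
  have yt : y * t = t * y.
    rewrite /t !mulrA.
    have := weyl_expr i 1 e; rewrite muln1 !expr1 => e1.
    have -> : y * x ^+ i = b^-1 *: (x ^+ i * y).
      by rewrite e1 -ei scalerA mulVf // scale1r.
    rewrite -!scalerAl -[x ^+ i * y * _]mulrA -exprS exprSr -!mulrA eb -!scalerAr.
    by rewrite scalerA mulVf // scale1r.
  have tp : proj_eq (t ^+ p) 1.
    rewrite /t cent_exprM ?cent_exprM //; [|exact: CX|exact: CX|apply: CM; exact: CX].
    rewrite zp mulr1 -!exprM mulnC [((p - j) * p)%N]mulnC !exprM.
    by rewrite (proj_eqX1 _ xp) (proj_eqX1 _ yp) mulr1; reflexivity.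
  have [k ek] := commuting_dependent pp sqf Cx Ct xt nx xp tp.
  (* Commuting with x makes t a power x^k up to a scalar; commuting with y then forces w^k = 1. *)
  have pk : (p %| k)%N.
    rewrite (prim_order_dvd pw).
    have := weyl_expr k 1 e; rewrite muln1 !expr1 => e1.
    have uyx : y * x ^+ k \is a GRing.unit by rewrite mul_unit ?unitrX.
    apply/eqP/(scale_unit_inj uyx); rewrite -e1 scale1r.
    have [c c0 ec] := proj_eq_sym ek.
    by rewrite ec -scalerAl -scalerAr yt.
  have t1 : proj_eq t 1 by rewrite ek; apply: proj_eqX_dvd xp pk.
  (* [p * i - i] represents -i modulo p without leaving the naturals. *)
  exists (p * i - i)%N, j.
  have ile : (i <= p * i)%N by rewrite leq_pmull ?prime_gt0.
  have h1 : proj_eq (y ^+ (p - j) * z) (x ^+ (p * i - i)).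
    apply: (proj_eqMl (unitrX i ux)); rewrite mulrA -exprD subnKC // exprM.
    by rewrite (proj_eqX1 _ xp) -/t t1; reflexivity.
  rewrite cent_commX //; apply: (proj_eqMl (unitrX (p - j) uy)).
  rewrite h1 mulrA -exprD subnK ?(ltnW (ltn_ord j)) // yp mul1r.
  by reflexivity.
Qed.

End Structure.

(** * Squarefree arithmetic and gluing over the primes *)

Lemma expr1_coprime (F : fieldType) (w : F) a b : (0 < a)%N -> coprime a b ->
  w ^+ a = 1 -> w ^+ b = 1 -> w = 1.
Proof.
move=> a0 /eqP cab wa wb; case: (egcdnP b a0) => k l e _.
have : w ^+ (k * a) = 1 by rewrite mulnC exprM wa expr1n.
by rewrite e cab exprD mulnC exprM wb expr1n mul1r expr1.
Qed.

Lemma squarefree_primes_prod n : (0 < n)%N -> squarefree n ->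
  (\prod_(p <- primes n) p = n)%N.
Proof.
move=> n0 sqf; rewrite [RHS]prod_prime_decomp // prime_decompE big_map /=.
apply: eq_big_seq => p; rewrite mem_primes => /and3P[pp _ pn].
have -> : logn p n = 1%N; last by rewrite expn1.
apply/eqP; rewrite eqn_leq logn_gt0 mem_primes pp n0 pn !andbT.
by rewrite leqNgt -(pfactor_dvdn _ pp n0) expnS expn1 sqf.
Qed.

Lemma squarefree_dvd_eq n a b : (0 < n)%N -> squarefree n -> (a %| n)%N -> (b %| n)%N ->
  (forall p, prime p -> (p %| a)%N <-> (p %| b)%N) -> a = b.
Proof.
move=> n0 sqf an bn h.
have a0 := dvdn_gt0 n0 an; have b0 := dvdn_gt0 n0 bn.
have sa : squarefree a by move=> p pp; apply: contra (sqf p pp) => /dvdn_trans; apply.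
have sb : squarefree b by move=> p pp; apply: contra (sqf p pp) => /dvdn_trans; apply.
rewrite -(squarefree_primes_prod a0 sa) -(squarefree_primes_prod b0 sb).
congr (\big[_/_]_(i <- _) _); apply/eq_primes => p.
rewrite !mem_primes a0 b0 /=; case pp: (prime p) => //=.
by apply/idP/idP => /h; apply.
Qed.

Section Structure.
Variables (F : closedFieldType) (m : nat).
Hypothesis charF0 : [pchar F] =i pred0.
Local Notation M := 'M[F]_m.+1.
Variable H : M -> Prop.
Hypothesis subH : forall A, H A -> \det A = 1.
Hypothesis irrH : irreducibleSL H.
Local Notation C := (centPSL H).

Let Cu x : C x -> x \is a GRing.unit := @cent_unit _ _ H x.
Let CM x y : C x -> C y -> C (x * y) := @cent_mul _ _ H subH x y.
Let CX x k : C x -> C (x ^+ k) := @cent_pow _ _ H subH x k.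

Let exprMC x y k (Cx : C x) (Cy : C y) := cent_exprM subH irrH k Cx Cy.

(** The pairing value has order dividing both a and b. *)
Lemma coprime_orders_commute x y a b : (0 < a)%N -> coprime a b -> C x -> C y ->
  proj_eq (x ^+ a) 1 -> proj_eq (y ^+ b) 1 -> x * y = y * x.
Proof.
move=> a0 cab Cx Cy xa yb; have [w w0 e] := cent_weyl subH irrH Cx Cy.
have wa := weyl_unity Cx Cy e xa; have wb := weyl_unity_r Cx Cy e yb.
by rewrite e (expr1_coprime a0 cab wa wb) scale1r.
Qed.

Lemma presents_uD D d1 d2 u v : presents H D d1 d2 u v -> proj_eq (u ^+ D) 1.
Proof. by case=> d1D _ /Cu uu _ ud _ _ _ _; apply: proj_eqX_dvd ud d1D. Qed.

Lemma presents_vD D d1 d2 u v : presents H D d1 d2 u v -> proj_eq (v ^+ D) 1.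
Proof.
by case=> d1D d2d1 _ /Cu uv _ vd _ _ _; apply: proj_eqX_dvd vd (dvdn_trans d2d1 d1D).
Qed.

(** Elements of coprime orders commute, so the pairs (u, v) and (x, y) do not interact and the
    pairing of u x with v y is the product w z, of order d2 e2. *)
Lemma presents_mul D E d1 d2 e1 e2 u v x y : (0 < D)%N -> (0 < E)%N -> coprime D E ->
  presents H D d1 d2 u v -> presents H E e1 e2 x y ->
  presents H (D * E) (d1 * e1) (d2 * e2) (u * x) (v * y).
Proof.
move=> D0 E0 cDE P Q.
have [uD vD] := (presents_uD P, presents_vD P).
have [xE yE] := (presents_uD Q, presents_vD Q).
case: (P) => d1D d2d1 Cuu Cv ud vd ordu [w ew pw] genD.
case: (Q) => e1E e2e1 Cx Cy xe ye ordx [z ez pz] genE.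
have uy := coprime_orders_commute D0 cDE Cuu Cy uD yE.
have vx := coprime_orders_commute D0 cDE Cv Cx vD xE.
have vy := coprime_orders_commute D0 cDE Cv Cy vD yE.
have d2D := dvdn_trans d2d1 d1D; have e2E := dvdn_trans e2e1 e1E.
have cd a b : (a %| D)%N -> (b %| E)%N -> coprime a b.
  by move=> aD bE; apply: coprime_dvdl aD _; apply: coprime_dvdr bE _.
split.
- exact: dvdn_mul.
- exact: dvdn_mul.
- exact: CM.
- exact: CM.
- rewrite exprMC //.
  rewrite [u ^+ _]exprM [(d1 * e1)%N]mulnC [x ^+ _]exprM.
  by rewrite (proj_eqX1 _ ud) (proj_eqX1 _ xe) mulr1; reflexivity.
- rewrite exprMC //.
  rewrite [v ^+ _]exprM [(d2 * e2)%N]mulnC [y ^+ _]exprM.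
  by rewrite (proj_eqX1 _ vd) (proj_eqX1 _ ye) mulr1; reflexivity.
- move=> i; rewrite exprMC // => h.
  (* Raising the relation to the power E removes x, and raising it to the power D removes u. *)
  rewrite Gauss_dvd ?cd //; apply/andP; split.
    have : proj_eq (u ^+ (i * E)) 1.
      have := proj_eqX1 E h; rewrite exprMC //; [|exact: CX|exact: CX].
      by rewrite -[X in _ * X]exprM mulnC [X in _ * X]exprM (proj_eqX1 _ xE) mulr1 -exprM mulnC.
    by move/ordu; rewrite Gauss_dvdl // cd.
  have : proj_eq (x ^+ (i * D)) 1.
    have := proj_eqX1 D h; rewrite exprMC //; [|exact: CX|exact: CX].
    by rewrite -[X in X * _]exprM mulnC [X in X * _]exprM (proj_eqX1 _ uD) mul1r -exprM mulnC.
  by move/ordx; rewrite Gauss_dvdl // coprime_sym cd.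
- exists (w * z).
    rewrite -mulrA [x * _]mulrA -vx -[v * x * y]mulrA ez -!scalerAr mulrA ew.
    rewrite -scalerAl scalerA mulrC; congr (_ *: _).
    by rewrite -!mulrA [u * (y * x)]mulrA uy -!mulrA.
  have [wd zd] := (prim_expr_order pw, prim_expr_order pz).
  apply: primitive_root_intro.
  + by rewrite muln_gt0 (prim_order_gt0 pw) (prim_order_gt0 pz).
  + by rewrite exprMn exprM wd mulnC exprM zd !expr1n mulr1.
  + move=> k wzk; rewrite Gauss_dvd ?cd //; apply/andP; split.
      have : w ^+ (k * e2) = 1.
        by have := congr1 (fun t => t ^+ e2) wzk; rewrite expr1n -exprM exprMn
          [X in z ^+ X]mulnC [z ^+ _]exprM zd expr1n mulr1.
      by move/eqP; rewrite -(prim_order_dvd pw) Gauss_dvdl // cd.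
    have : z ^+ (k * d2) = 1.
      by have := congr1 (fun t => t ^+ d2) wzk; rewrite expr1n -exprM exprMn
        [X in w ^+ X]mulnC [w ^+ _]exprM wd expr1n mul1r.
    by move/eqP; rewrite -(prim_order_dvd pz) Gauss_dvdl // coprime_sym cd.
- move=> t Ct tDE; have ut := Cu Ct.
  (* The two exponents are the Chinese-remainder idempotents, so t1 and t2 are the D-part and the
     E-part of t. *)
  pose t1 := t ^+ chinese D E 1 0; pose t2 := t ^+ chinese D E 0 1.
  have et : proj_eq t (t1 * t2).
    rewrite -exprD -{1}[t]expr1; apply: proj_eqX_mod tDE _ => //.
    apply/eqP; rewrite (chinese_remainder cDE); apply/andP; split; apply/eqP.
      by rewrite -modnDm !chinese_modl // modnDm.
    by rewrite -modnDm !chinese_modr // modnDm.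
  have t1D : proj_eq (t1 ^+ D) 1.
    rewrite -exprM; apply: proj_eqX_dvd tDE _ => //; rewrite mulnC dvdn_mul //.
    by rewrite /dvdn chinese_modr // mod0n.
  have t2E : proj_eq (t2 ^+ E) 1.
    rewrite -exprM; apply: proj_eqX_dvd tDE _ => //; rewrite dvdn_mul //.
    by rewrite /dvdn chinese_modl // mod0n.
  have [i [j eij]] := genD t1 (CX _ Ct) t1D.
  have [k [l ekl]] := genE t2 (CX _ Ct) t2E.
  exists (chinese D E i k), (chinese D E j l).
  rewrite et eij ekl !exprMC //.
  rewrite (proj_eqX_mod (Cu Cuu) uD (chinese_modl cDE i k)).
  rewrite (proj_eqX_mod (Cu Cx) xE (chinese_modr cDE i k)).
  rewrite (proj_eqX_mod (Cu Cv) vD (chinese_modl cDE j l)).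
  rewrite (proj_eqX_mod (Cu Cy) yE (chinese_modr cDE j l)).
  rewrite -!mulrA [v ^+ j * (x ^+ k * _)]mulrA (cent_commX subH irrH j k Cv Cx).
  by rewrite -!mulrA; reflexivity.
Qed.

Lemma presents_primes s : uniq s -> all prime s -> squarefree m.+1 ->
  exists d1 d2 u v, presents H (\prod_(p <- s) p) d1 d2 u v.
Proof.
move=> us ps sqf; elim: s us ps => [_ _|p s IH /= /andP[ps us] /andP[pp pr]].
  exists 1%N, 1%N, 1, 1; rewrite big_nil.
  by apply: (presents1 subH) => x Cx; rewrite expr1.
have [d1 [d2 [u [v P]]]] := IH us pr.
have [e1 [e2 [x [y Q]]]] := presents_prime charF0 subH irrH pp (sqf p pp).
exists (e1 * d1)%N, (e2 * d2)%N, (x * u), (y * v); rewrite big_cons.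
apply: presents_mul => //; first exact: prime_gt0.
  by rewrite big_seq prodn_cond_gt0 // => q /(allP pr)/prime_gt0.
rewrite prime_coprime //; apply/negP => h.
have [q qs pq] : exists2 q, q \in s & (p %| q)%N.
  elim: (s) h => [|q r IHr]; first by rewrite big_nil dvdn1 => /eqP p1; rewrite p1 in pp.
  rewrite big_cons Euclid_dvdM // => /orP[pq|/IHr[q' qr pq]].
    by exists q; rewrite ?mem_head.
  by exists q'; rewrite // in_cons qr orbT.
move: pq; rewrite dvdn_prime2 ?(allP pr q qs) // => /eqP pq.
by move: ps; rewrite pq qs.
Qed.

Lemma presents_exists : squarefree m.+1 -> exists d1 d2 u v, presents H m.+1 d1 d2 u v.
Proof.
move=> sqf; have := presents_primes (primes_uniq m.+1) _ sqf.
rewrite squarefree_primes_prod //; apply.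
by apply/allP => p; rewrite mem_primes => /andP[].
Qed.

(** Together with [has_rank2], an invariant expressed in the group C/Z alone, hence transported by
    abstract isomorphisms. For primes p they detect p | d1 and p | d2 respectively. *)
Definition has_order p := exists x, [/\ C x, ~ proj_eq x 1 & proj_eq (x ^+ p) 1].

Definition has_rank2 p := exists x y, [/\ C x, C y, proj_eq (x ^+ p) 1, proj_eq (y ^+ p) 1 &
  forall i j, proj_eq (x ^+ i * y ^+ j) 1 -> (p %| i)%N /\ (p %| j)%N].

(** A scalar u^i v^j commutes with u, which gives w^j = 1 and so d2 | j. Then v^j is scalar, and so
    is u^i. *)
Lemma presents_indep D d1 d2 u v i j : presents H D d1 d2 u v ->
  proj_eq (u ^+ i * v ^+ j) 1 -> (d1 %| i)%N /\ (d2 %| j)%N.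
Proof.
case=> d1D d2d1 Cuu Cv ud vd ordu [w ew pw] _ h.
have [uu uv] := (Cu Cuu, Cu Cv).
have dj : (d2 %| j)%N.
  rewrite (prim_order_dvd pw); have := weyl_expr 1 j ew; rewrite mul1n !expr1 => e1.
  have : u ^+ i * (u * v ^+ j) = u ^+ i * (v ^+ j * u).
    by rewrite !mulrA -exprSr exprS -[u * _ * _]mulrA -(proj_eq1_comm u h).
  move/(mulrI (unitrX i uu)); rewrite e1 => e2; apply/eqP.
  apply: (@scale_unit_inj _ _ _ _ (v ^+ j * u)); first by rewrite mul_unit ?unitrX.
  by rewrite e2 scale1r.
split=> //; apply: ordu; move: h.
by rewrite (proj_eqX_dvd uv vd dj) mulr1.
Qed.

(** The element u^(d1/p) has order p. Conversely d1 annihilates C/Z, so p-torsion is trivial when p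
    is prime to d1. *)
Lemma presents_has_order d1 d2 u v p : prime p -> presents H m.+1 d1 d2 u v ->
  (p %| d1)%N <-> has_order p.
Proof.
move=> pp P; have := P; case=> d1D d2d1 Cuu Cv ud vd ordu [w ew pw] gen.
have d10 := dvdn_gt0 (ltn0Sn _) d1D.
split=> [pd|[x [Cx nx xp]]].
  exists (u ^+ (d1 %/ p)); split; first exact: CX.
    move/ordu => /(dvdn_leq _); rewrite divn_gt0 ?prime_gt0 // => /(_ (dvdn_leq d10 pd)).
    by rewrite leqNgt ltn_Pdiv // prime_gt1.
  by rewrite -exprM divnK.
apply/negPn/negP => pd; apply: nx; apply: (@proj_eqX_coprime _ _ _ d1 p (Cu Cx) _ _ xp).
  by rewrite coprime_sym prime_coprime.
have [i [j eij]] := gen x Cx (cent_exp subH irrH Cx).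
rewrite (proj_eqX d1 eij) exprMC //; [|exact: CX|exact: CX].
rewrite -!exprM mulnC [(j * _)%N]mulnC !exprM.
by rewrite (proj_eqX1 _ ud) (proj_eqX1 _ (proj_eqX_dvd (Cu Cv) vd d2d1)) mulr1; reflexivity.
Qed.

(** If p | d2, the powers u^(d1/p) and v^(d2/p) are independent. If not, d2-th powers of p-torsion
    elements lie in the group of u, hence commute, and squarefreeness makes them dependent. *)
Lemma presents_has_rank2 d1 d2 u v p : prime p -> squarefree m.+1 ->
  presents H m.+1 d1 d2 u v -> (p %| d2)%N <-> has_rank2 p.
Proof.
move=> pp sqf P; have := P; case=> d1D d2d1 Cuu Cv ud vd ordu [w ew pw] gen.
have d10 := dvdn_gt0 (ltn0Sn _) d1D; have d20 := dvdn_gt0 d10 d2d1.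
split=> [pd|[x [y [Cx Cy xp yp ind]]]].
  have pd1 := dvdn_trans pd d2d1.
  exists (u ^+ (d1 %/ p)), (v ^+ (d2 %/ p)); split; try exact: CX.
  - by rewrite -exprM divnK.
  - by rewrite -exprM divnK.
  - have aux d i : (0 < d)%N -> (p %| d)%N -> (d %| d %/ p * i)%N -> (p %| i)%N.
      move=> d0 /dvdnP[q dq]; move: d0; rewrite dq muln_gt0 (mulnK _ (prime_gt0 pp)).
      by case/andP=> q0 _; rewrite dvdn_pmul2l.
    by move=> i j; rewrite -!exprM => /(presents_indep P)[/aux h1 /aux h2]; split; auto.
apply/negPn/negP => pd.
have cpd : coprime d2 p by rewrite coprime_sym prime_coprime.
have p2 t : C t -> proj_eq (t ^+ p) 1 -> exists i, proj_eq (t ^+ d2) (u ^+ i).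
  move=> Ct tp; have [i [j eij]] := gen t Ct (cent_exp subH irrH Ct).
  exists (i * d2)%N; rewrite (proj_eqX d2 eij) exprMC //; [|exact: CX|exact: CX].
  by rewrite -!exprM [(j * _)%N]mulnC [v ^+ _]exprM (proj_eqX1 _ vd) mulr1; reflexivity.
have [i ei] := p2 x Cx xp; have [j ej] := p2 y Cy yp.
have xy : x ^+ d2 * y ^+ d2 = y ^+ d2 * x ^+ d2.
  have [[a a0 ->] [b b0 ->]] := (ei, ej).
  by rewrite -!scalerAl -!scalerAr -!exprD addnC !scalerA mulrC.
have nx : ~ proj_eq (x ^+ d2) 1.
  rewrite -[x ^+ d2]mulr1 -[X in _ * X](expr0 y) => /ind[pd2 _].
  by rewrite pd2 in pd.
have [||k ek] := commuting_dependent charF0 subH irrH pp (sqf p pp) (CX d2 Cx) (CX d2 Cy) xy nx.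
- by rewrite -exprM mulnC exprM; apply: proj_eqX1.
- by rewrite -exprM mulnC exprM; apply: proj_eqX1.
have [|_] := ind (d2 * (p * k - k))%N d2; last by rewrite (negPf pd).
rewrite ek -exprM -exprD -mulnDr subnK ?leq_pmull ?prime_gt0 //.
by rewrite mulnCA exprM; apply: proj_eqX1.
Qed.


End Structure.

(** * Conjugacy of Weyl pairs *)

Section IdempotentEquivalence.
Variables (F : fieldType) (m : nat).
Local Notation M := 'M[F]_m.+1.

(** With the rank as a variable k, two idempotents of equal rank factor through the same type of
    matrices without a cast. *)
Lemma idem_factor_rank (E : M) k : \rank E = k -> E * E = E ->
  exists C : 'M[F]_(m.+1, k), exists2 R : 'M[F]_(k, m.+1), E = C *m R & R *m C = 1%:M.
Proof. by move=> <-; apply: idem_factor. Qed.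

(** With E = C R and E' = C' R', take X = C R' and Y = C' R: mutually inverse identifications of the
    two images. *)
Lemma idem_equiv (E E' : M) : E * E = E -> E' * E' = E' -> \rank E = \rank E' ->
  exists X Y : M, [/\ X * Y = E, E * X = X, X * E' = X & E' * Y = Y].
Proof.
move=> idE idE'; move: (erefl (\rank E')); move: {1 3}(\rank E') => k rk' rk.
have [C [R eE RC]] := idem_factor_rank rk idE.
have [C' [R' eE' RC']] := idem_factor_rank (esym rk') idE'.
exists (C *m R'), (C' *m R); rewrite eE eE'; rewrite -!mulmxE.
split; rewrite mulmxA.
- by rewrite -(mulmxA C) RC' mulmx1.
- by rewrite -(mulmxA C R) RC mulmx1.
- by rewrite -(mulmxA C R') RC' mulmx1.
- by rewrite -(mulmxA C' R') RC' mulmx1.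
Qed.

End IdempotentEquivalence.

Section WeylPair.
Variables (F : fieldType) (m : nat).
Hypothesis charF0 : [pchar F] =i pred0.
Local Notation M := 'M[F]_m.+1.
Variables (z : F) (q d : nat).
Local Notation n1 := (d * q)%N.
Hypothesis pz : n1.-primitive_root z.

(** Powers are normalized to equal 1 exactly, and the pairing value is the prescribed root z^q of
    order d. Traceless proper powers give all eigenvalues of u the same multiplicity. *)
Definition weyl_pair (u v : M) : Prop :=
  [/\ u ^+ n1 = 1, v ^+ d = 1, u * v = z ^+ q *: (v * u) &
      forall i, (0 < i < n1)%N -> \tr (u ^+ i) = 0].

Let n10 : (0 < n1)%N := prim_order_gt0 pz.
Let d0 : (0 < d)%N. Proof. by move: n10; rewrite muln_gt0 => /andP[]. Qed.
Let q0 : (0 < q)%N. Proof. by move: n10; rewrite muln_gt0 => /andP[]. Qed.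
Let z0 : z != 0. Proof. by rewrite (prim_root_eq0 pz) -lt0n. Qed.

(** The projector onto the eigenspace of u for z^-i. *)
Definition eproj (u : M) i : M := cyc_proj n1 (z ^+ i *: u).

Section OnePair.
Variables u v : M.
Hypothesis uv : weyl_pair u v.

Lemma zu_exp i : (z ^+ i *: u) ^+ n1 = 1.
Proof.
by case: uv => un _ _ _; rewrite exprZn un -exprM mulnC exprM (prim_expr_order pz)
  expr1n scale1r.
Qed.

Lemma eproj_idem i : eproj u i * eproj u i = eproj u i.
Proof. by apply: cyc_proj_idem => //; apply: zu_exp. Qed.

Lemma eprojMl i : z ^+ i *: (u * eproj u i) = eproj u i.
Proof. by rewrite scalerAl cyc_projM //; apply: zu_exp. Qed.

Lemma eproj_comm i : eproj u i * u = u * eproj u i.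
Proof. by apply: cyc_proj_comm; rewrite -scalerAl -scalerAr. Qed.

Lemma eproj_orth i j : (i < n1)%N -> (j < n1)%N -> i != j -> eproj u i * eproj u j = 0.
Proof.
move=> ilt jlt ij; rewrite /eproj.
have zi0 : z ^+ i != 0 by rewrite expf_neq0.
have -> : z ^+ j *: u = (z ^+ j / z ^+ i) *: (z ^+ i *: u).
  by rewrite scalerA divfK.
apply: cyc_proj_orth => //; first exact: zu_exp.
  by rewrite exprMn exprVn -!exprM ![(_ * n1)%N]mulnC !(exprM _ n1) (prim_expr_order pz) !expr1n divr1.
apply: contraNneq ij => h; have : z ^+ j = z ^+ i by rewrite -[LHS](divfK zi0) h mul1r.
by move/eqP; rewrite (eq_prim_root_expr pz) !modn_small // eq_sym.
Qed.

Lemma eproj_rank i : (\rank (eproj u i))%:R = n1%:R^-1 * m.+1%:R :> F.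
Proof.
rewrite -(idem_tr (eproj_idem i)) cyc_proj_tr // => k kn.
by case: uv => _ _ _ tr0; rewrite exprZn mxtraceZ tr0 ?mulr0.
Qed.

(** Thus v permutes the eigenspaces of u, moving the index by q; the indices r < q represent the
    orbits. *)
Lemma eproj_shift i j : eproj u i * v ^+ j = v ^+ j * eproj u (i + j * q).
Proof.
case: uv => _ _ e _; rewrite /eproj /cyc_proj -scalerAl -scalerAr mulr_suml mulr_sumr.
congr (_ *: _); apply: eq_bigr => k _; rewrite !exprZn -scalerAl -scalerAr.
rewrite (weyl_expr k j e) scalerA -!exprM -exprD; congr (_ ^+ _ *: _).
by lia.
Qed.

Lemma sum_eproj_blocks :
  \sum_(0 <= j < d) \sum_(r < q) eproj u (r + j * q) = 1.
Proof.
rewrite -(cyc_proj_sum charF0 u pz) big_nat_mul; apply: eq_bigr => j _.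
rewrite -[X in \sum_(X <= _ < _) _]add0n big_addn mulSn addnK big_mkord.
by [].
Qed.

Lemma pair_inv : exists2 w, v * w = 1 & w * v = 1 /\
  forall t, (t <= d)%N -> w ^+ t = v ^+ (d - t).
Proof.
case: uv => _ vd _ _; exists (v ^+ d.-1); first by rewrite -exprS prednK.
split; first by rewrite -exprSr prednK.
have wv : v ^+ d.-1 * v = 1 by rewrite -exprSr prednK.
elim=> [_|t IH td]; first by rewrite expr0 subn0.
rewrite exprSr IH; last exact: ltnW.
have -> : (d - t)%N = (d - t.+1).+1 by lia.
by rewrite exprSr -mulrA -exprS prednK // vd mulr1.
Qed.

End OnePair.

(** The eigenspaces of u and u' have equal dimensions. An identification X of those with index r < q
    is extended to the whole space compatibly with v and v', as g = sum of v^-j X v'^j. *)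
Lemma weyl_pair_conj u v u' v' : weyl_pair u v -> weyl_pair u' v' ->
  exists2 g : M, g \is a GRing.unit & u * g = g * u' /\ v * g = g * v'.
Proof.
move=> P P'.
have [w vw [wv wt]] := pair_inv P; have [w' vw' [wv' wt']] := pair_inv P'.
have lt_q (r : 'I_q) j : (j < d)%N -> (r + j * q < n1)%N.
  by move=> jd; have := ltn_ord r; move: jd q0; clear; nia.
have choose_XY (r : 'I_q) : exists XY : M * M,
    [/\ XY.1 * XY.2 = eproj u r, eproj u r * XY.1 = XY.1, XY.1 * eproj u' r = XY.1
      & eproj u' r * XY.2 = XY.2].
  have rk : \rank (eproj u r) = \rank (eproj u' r).
    by apply: (natr_inj_char0 charF0); rewrite (eproj_rank P) (eproj_rank P').
  have [X [Y h]] := idem_equiv (eproj_idem P r) (eproj_idem P' r) rk.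
  by exists (X, Y).
have [XY hXY] := fin_all_exists choose_XY.
pose X := \sum_r (XY r).1; pose Y := \sum_r (XY r).2.
pose eps := \sum_(r < q) eproj u r; pose eps' := \sum_(r < q) eproj u' r.
have orth' (r s : 'I_q) : r != s -> eproj u' r * eproj u' s = 0.
  move=> rs; apply: (eproj_orth P') => //.
  - by have := lt_q r 0%N d0; rewrite mul0n addn0.
  - by have := lt_q s 0%N d0; rewrite mul0n addn0.
have XYe : X * Y = eps.
  rewrite /X mulr_suml; apply: eq_bigr => r _; rewrite mulr_sumr (bigD1 r) //= big1.
    by rewrite addr0; case: (hXY r).
  move=> s sr; have [_ _ <- _] := hXY r; have [_ _ _ <-] := hXY s.
  by rewrite mulrA -[_ * _ * eproj u' s]mulrA orth' 1?eq_sym // mulr0 mul0r.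
have Xe : X * eps' = X.
  rewrite /X mulr_suml; apply: eq_bigr => r _; rewrite mulr_sumr (bigD1 r) //= big1.
    by rewrite addr0; case: (hXY r).
  move=> s sr; have [_ _ <- _] := hXY r.
  by rewrite -mulrA orth' 1?eq_sym // mulr0.
have eY : eps' * Y = Y.
  rewrite /Y mulr_sumr; apply: eq_bigr => r _; rewrite mulr_suml (bigD1 r) //= big1.
    by rewrite addr0; case: (hXY r).
  move=> s sr; have [_ _ _ <-] := hXY r.
  by rewrite mulrA orth' // mul0r.
have uX : u * X = X * u'.
  rewrite /X mulr_suml mulr_sumr; apply: eq_bigr => r _.
  have zr0 : z ^+ r != 0 by rewrite expf_neq0.
  have [_ h1 h2 _] := hXY r; apply: (scalerI zr0).
  rewrite -{1}h1 mulrA scalerAl (eprojMl P) h1.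
  by rewrite -{2}h2 -mulrA scalerAr (eproj_comm u' r) (eprojMl P') h2.
(* For 0 < t < d, v'^t carries the block of indices below q to a disjoint block. *)
have cross t : (0 < t < d)%N -> X * v' ^+ t * Y = 0.
  case/andP=> t0 td; rewrite -Xe -eY !mulrA -[X * _ * _]mulrA -[X * _ * eps']mulrA.
  suff -> : eps' * v' ^+ t * eps' = 0 by rewrite mulr0 mul0r.
  rewrite mulr_suml mulr_suml big1 // => r _; rewrite (eproj_shift P') mulr_sumr big1 // => s _.
  rewrite -mulrA (eproj_orth P') ?mulr0 //; first exact: lt_q.
    by have := lt_q s 0%N d0; rewrite mul0n addn0.
  by have := ltn_ord s; move: t0 q0; clear; nia.
have wtd : w ^+ d = 1 by rewrite wt // subnn expr0.
have [[_ vd e _] [_ vd' e' _]] := (P, P').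
have wvj j : w ^+ j * v ^+ j = 1.
  by rewrite -exprMn_comm ?wv ?expr1n // /GRing.comm wv vw.
have vwj' j : v' ^+ j * w' ^+ j = 1.
  by rewrite -exprMn_comm ?vw' ?expr1n // /GRing.comm wv' vw'.
have vwj j : v ^+ j * w ^+ j = 1.
  by rewrite -exprMn_comm ?vw ?expr1n // /GRing.comm wv vw.
pose g := \sum_(0 <= j < d) w ^+ j * X * v' ^+ j.
pose h := \sum_(0 <= j < d) w' ^+ j * Y * v ^+ j.
have gh : g * h = 1.
  rewrite -(sum_eproj_blocks u) /g mulr_suml; apply: eq_big_nat => j /andP[_ jd].
  rewrite mulr_sumr (bigD1_seq j) /= ?mem_index_iota ?iota_uniq //.
  rewrite big_seq_cond big1 ?addr0; last first.
    move=> k /andP[]; rewrite mem_index_iota /= => kd kj.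
    (* Off-diagonal terms of g h vanish by [cross]: v'^j w'^k is a power v'^t with 0 < t < d. *)
    suff [t t0 et] : exists2 t, (0 < t < d)%N & v' ^+ j * w' ^+ k = v' ^+ t.
      by rewrite !mulrA -[_ * v' ^+ j * _]mulrA et -!mulrA [v' ^+ t * _]mulrA
        [X * _]mulrA [X * _]mulrA cross // mul0r mulr0.
    case: (ltngtP j k) kj => // jk _.
    - exists (d - (k - j))%N; first by lia.
      rewrite -wt'; last by lia.
      by rewrite -{1}(subnKC (ltnW jk)) exprD mulrA vwj' mul1r.
    - exists (j - k)%N; first by lia.
      by rewrite -{1}(subnK (ltnW jk)) exprD -mulrA vwj' mulr1.
  rewrite !mulrA -[_ * v' ^+ j * _]mulrA vwj' mulr1 -[_ * X * Y]mulrA XYe.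
  rewrite mulr_sumr mulr_suml; apply: eq_bigr => r _.
  by rewrite -mulrA (eproj_shift P) mulrA wvj mul1r.
exists g; first by have [] := mulmx1_unit gh.
(* Cyclic reindexing of the sum, as w^d = v'^d = 1. *)
have shift : w * g * v' = g.
  rewrite /g mulr_sumr mulr_suml.
  rewrite (eq_bigr (fun j => w ^+ j.+1 * X * v' ^+ j.+1)); last first.
    by move=> j _; rewrite exprS exprSr !mulrA.
  case: (d) d0 wtd vd' => // k _ wk vk; rewrite big_nat_recr //= wk vk.
  by rewrite [RHS]big_nat_recl // !expr0 addrC.
split; last by rewrite -{1}shift !mulrA vw mul1r.
rewrite /g mulr_sumr mulr_suml; apply: eq_bigr => j _.
have h1 := weyl_expr 1 j e; rewrite mul1n !expr1 in h1.
have h2 := weyl_expr 1 j e'; rewrite mul1n !expr1 in h2.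
have c0 : (z ^+ q) ^+ j != 0 by rewrite !expf_neq0.
have h3 : w ^+ j * u = (z ^+ q) ^+ j *: (u * w ^+ j).
  by rewrite -[LHS]mulr1 -(vwj j) mulrA -[_ * u * _]mulrA h1 -scalerAr mulrA wvj mul1r scalerAl.
apply: (scalerI c0); transitivity (w ^+ j * u * X * v' ^+ j).
  by rewrite h3 -!scalerAl !mulrA.
transitivity (w ^+ j * X * (u' * v' ^+ j)); last by rewrite h2 -scalerAr !mulrA.
by rewrite -[w ^+ j * u * X]mulrA uX !mulrA.
Qed.

End WeylPair.

(** * Isomorphisms modulo scalars as relations *)

Section Correspondence.
Variables (F : closedFieldType) (m : nat).
Local Notation M := 'M[F]_m.+1.

(** A relation rather than a map, so that an isomorphism and its inverse are treated by the same
    lemmas. *)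
Definition proj_corr (C1 C2 : M -> Prop) (R : M -> M -> Prop) : Prop :=
  [/\ forall x, C1 x -> exists2 y, C2 y & R x y,
      R 1 1,
      forall x y x' y', R x y -> R x' y' -> R (x * x') (y * y') &
      forall x y, R x y -> proj_eq x 1 <-> proj_eq y 1].

Lemma proj_corrX C1 C2 R x y k : proj_corr C1 C2 R -> R x y -> R (x ^+ k) (y ^+ k).
Proof.
by case=> _ R1 RM _ xy; elim: k => [|k IH]; rewrite ?expr0 // !exprS; apply: RM.
Qed.

Lemma has_order_corr H1 H2 R p : proj_corr (centPSL H1) (centPSL H2) R ->
  has_order H1 p -> has_order H2 p.
Proof.
move=> cR; have [tot R1 RM Rs] := cR.
move=> [x [Cx nx xp]]; have [y Cy xy] := tot x Cx; exists y; split=> //.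
  by move/(Rs _ _ xy).
exact/(Rs _ _ (proj_corrX p cR xy)).
Qed.

Lemma has_rank2_corr H1 H2 R p : proj_corr (centPSL H1) (centPSL H2) R ->
  has_rank2 H1 p -> has_rank2 H2 p.
Proof.
move=> cR; have [tot R1 RM Rs] := cR.
move=> [x [x' [Cx Cx' xp xp' ind]]].
have [y Cy xy] := tot x Cx; have [y' Cy' xy'] := tot x' Cx'.
exists y, y'; split=> //.
- exact/(Rs _ _ (proj_corrX p cR xy)).
- exact/(Rs _ _ (proj_corrX p cR xy')).
- move=> i j h; apply: ind.
  exact: (Rs _ _ (RM _ _ _ _ (proj_corrX i cR xy) (proj_corrX j cR xy'))).2 h.
Qed.

Lemma isoPSL_corr (H1 H2 : M -> Prop) :
  (forall A, H1 A -> \det A = 1) -> (forall A, H2 A -> \det A = 1) ->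
  isoPSL (centPSL H1) (centPSL H2) ->
  exists R, proj_corr (centPSL H1) (centPSL H2) R /\
            proj_corr (centPSL H2) (centPSL H1) (fun y x => R x y).
Proof.
move=> sub1 sub2 [f [fC fwd fM finj fsurj]].
have d1 x : centPSL H1 x -> \det x = 1 by case.
have d2 x : centPSL H2 x -> \det x = 1 by case.
have C11 := cent_one sub1.
have CM1 x y (Cx : centPSL H1 x) (Cy : centPSL H1 y) := cent_mul sub1 Cx Cy.
have CM2 x y (Cx : centPSL H2 x) (Cy : centPSL H2 y) := cent_mul sub2 Cx Cy.
have fM' x y : centPSL H1 x -> centPSL H1 y -> proj_eq (f (x * y)) (f x * f y).
  move=> Cx Cy; apply/(modZE (d2 _ (fC _ (CM1 _ _ Cx Cy))) (d2 _ (CM2 _ _ (fC _ Cx) (fC _ Cy)))).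
  exact: fM.
have fwd' x y : centPSL H1 x -> centPSL H1 y -> proj_eq x y <-> proj_eq (f x) (f y).
  move=> Cx Cy; split=> h.
    apply/(modZE (d2 _ (fC _ Cx)) (d2 _ (fC _ Cy))); apply: fwd => //.
    exact/(modZE (d1 _ Cx) (d1 _ Cy)).
  apply/(modZE (d1 _ Cx) (d1 _ Cy)); apply: finj => //.
  exact/(modZE (d2 _ (fC _ Cx)) (d2 _ (fC _ Cy))).
have f1 : proj_eq (f 1) 1.
  have := fM' 1 1 C11 C11; rewrite mulr1 -{1}[f 1]mulr1.
  by move/(proj_eqMl (cent_unit (fC _ C11)))/proj_eq_sym.
pose R x y := [/\ centPSL H1 x, centPSL H2 y & proj_eq (f x) y].
have R1 : R 1 1 by split=> //; apply: cent_one.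
have RM x y x' y' : R x y -> R x' y' -> R (x * x') (y * y').
  move=> [Cx Cy xy] [Cx' Cy' xy']; split; [exact: CM1|exact: CM2|].
  by rewrite fM' // xy xy'; reflexivity.
have Rs x y : R x y -> proj_eq x 1 <-> proj_eq y 1.
  move=> [Cx Cy xy]; split=> h.
    apply: proj_eq_trans (proj_eq_sym xy) _; apply: proj_eq_trans _ f1.
    exact: (fwd' _ _ Cx C11).1 h.
  by apply: (fwd' _ _ Cx C11).2; rewrite xy h f1; reflexivity.
exists R; split; split=> //.
- by move=> x Cx; exists (f x); [exact: fC | split=> //; [exact: fC | reflexivity]].
- move=> y Cy; have [x Cx xy] := fsurj y Cy; exists x => //; split=> //.
  exact/(modZE (d2 _ (fC _ Cx)) (d2 _ Cy)).
- by move=> x y x' y'; apply: RM.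
- by move=> x y /Rs [h1 h2]; split.
Qed.

End Correspondence.

(** * Conjugacy in squarefree degree *)

Section Forward.
Variables (F : closedFieldType) (m : nat).
Hypothesis charF0 : [pchar F] =i pred0.
Local Notation M := 'M[F]_m.+1.

Lemma presents_weyl_pair (H : M -> Prop) (z : F) d q u v :
  (forall A, H A -> \det A = 1) -> irreducibleSL H -> (d * q)%N.-primitive_root z ->
  presents H m.+1 (d * q) d u v ->
  exists u' v', weyl_pair z q d u' v' /\
    forall x, centPSL H x <-> \det x = 1 /\ exists i j, proj_eq x (u' ^+ i * v' ^+ j).
Proof.
move=> subH irrH pz; case=> dD _ Cu Cv ud vd ordu [w ew pw] gen.
have n10 := prim_order_gt0 pz; have d0 := prim_order_gt0 pw.
have q0 : (0 < q)%N by move: n10; rewrite muln_gt0 => /andP[].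
have uv := cent_unit Cv.
have pzq : d.-primitive_root (z ^+ q).
  have := dvdn_prim_root pz (dvdn_mulr q (dvdnn d)).
  by rewrite mulnC mulnK.
(* Both w and z^q are primitive d-th roots, so each is a power of the other. Replacing v by v^k
   turns the pairing value into z^q, and v is recovered modulo scalars as (v^k)^l. *)
have [k ek] := prim_rootP pw (prim_expr_order pzq).
have [l el] := prim_rootP pzq (prim_expr_order pw).
have kl : (k * l = 1 %[mod d])%N.
  by apply/eqP; rewrite -(eq_prim_root_expr pw) exprM -ek -el expr1.
have vkd : proj_eq ((v ^+ k) ^+ d) 1.
  by rewrite -exprM mulnC exprM; apply: proj_eqX1.
have [u' eu' u'd] := proj_expr1_normalize n10 ud.
have [v' ev' v'd] := proj_expr1_normalize d0 vkd.
exists u', v'; split; [split=> //|].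
- have := weyl_expr 1 k ew; rewrite mul1n !expr1 -ek => e.
  have [[a a0 ->] [b b0 ->]] := (eu', ev').
  by rewrite -!scalerAl -!scalerAr e !scalerA; congr (_ *: _); ring.
- move=> i /andP[i0 id]; have [a a0 ->] := eu'; rewrite exprZn mxtraceZ.
  rewrite (cent_tr subH irrH) ?mulr0 //; first exact: cent_pow.
  by move/ordu; rewrite gtnNdvd.
- move=> x; split=> [Cx|[dx [i [j e]]]].
    split; first exact: cent_det Cx.
    have [i [j eij]] := gen x Cx (cent_exp subH irrH Cx).
    exists i, (l * j)%N; rewrite eij.
    rewrite exprM (proj_eqX i eu') (proj_eqX j (proj_eqX l ev')).
    have e : proj_eq (v ^+ k ^+ l) v by rewrite -exprM -{2}[v]expr1; apply: proj_eqX_mod vd kl.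
    by rewrite (proj_eqX j e); reflexivity.
  apply: (@cent_proj _ _ _ subH _ (u ^+ i * (v ^+ k) ^+ j)) => //.
    by apply: cent_mul => //; apply: cent_pow => //; apply: cent_pow.
  by rewrite e (proj_eqX i eu') (proj_eqX j ev'); reflexivity.
Qed.

(** The orders d1 and d2 are divisors of a squarefree number, hence determined by their primes,
    which are invariants of the abstract group. Both centralizers then come from Weyl pairs for the
    same z, and these are conjugate. *)
Lemma squarefree_conj (H1 H2 : M -> Prop) : squarefree m.+1 ->
  (forall A, H1 A -> \det A = 1) -> (forall A, H2 A -> \det A = 1) ->
  irreducibleSL H1 -> irreducibleSL H2 ->
  isoPSL (centPSL H1) (centPSL H2) -> conjPSL (centPSL H1) (centPSL H2).
Proof.
move=> sqf sub1 sub2 irr1 irr2 /(isoPSL_corr sub1 sub2)[R [R12 R21]].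
have [d1 [d2 [u1 [v1 P1]]]] := presents_exists charF0 sub1 irr1 sqf.
have [e1 [e2 [u2 [v2 P2]]]] := presents_exists charF0 sub2 irr2 sqf.
have dn1 := pr_d1 P1; have dn2 := dvdn_trans (pr_d2 P1) dn1.
have en1 := pr_d1 P2; have en2 := dvdn_trans (pr_d2 P2) en1.
have eq1 : e1 = d1.
  apply: (squarefree_dvd_eq _ sqf en1 dn1) => // p pp.
  rewrite (presents_has_order sub1 irr1 pp P1) (presents_has_order sub2 irr2 pp P2).
  by split; apply: has_order_corr; eassumption.
have eq2 : e2 = d2.
  apply: (squarefree_dvd_eq _ sqf en2 dn2) => // p pp.
  rewrite (presents_has_rank2 charF0 sub1 irr1 pp sqf P1).
  rewrite (presents_has_rank2 charF0 sub2 irr2 pp sqf P2).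
  by split; apply: has_rank2_corr; eassumption.
rewrite {}eq1 {}eq2 {dn1 dn2 en1 en2} in P2.
have /dvdnP[q dq] := pr_d2 P1; rewrite mulnC in dq; rewrite {}dq in P1 P2.
have [z pz] := exists_primitive_root charF0 (dvdn_gt0 (ltn0Sn m) (pr_d1 P1)).
have [u [v [W1 C1]]] := presents_weyl_pair sub1 irr1 pz P1.
have [u' [v' [W2 C2]]] := presents_weyl_pair sub2 irr2 pz P2.
have [g ug [eu ev]] := weyl_pair_conj charF0 pz W1 W2.
have ugV : g^-1 \is a GRing.unit by rewrite unitrV.
have [c c0 dG] := scale_to_det1 ugV.
(* From u g = g u' it follows that g x g^-1 takes the second group to the first; [conjPSL] therefore
   asks for g^-1, rescaled to determinant 1. *)
exists (c *: g^-1) => // x.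
have uc : c \is a GRing.unit by rewrite unitfE.
have -> : invmx (c *: g^-1) *m x *m (c *: g^-1) = g * x * g^-1.
  rewrite -[invmx _]/((c *: g^-1)^-1) invrZ // invrK.
  rewrite -[_ *m _ *m _]/(c^-1 *: g * x * (c *: g^-1)).
  by rewrite -!scalerAl -scalerAr scalerA mulVf // scale1r.
have euX i : u ^+ i * g = g * u' ^+ i.
  by elim: i => [|i IH]; rewrite ?expr0 ?mul1r ?mulr1 // !exprSr -mulrA eu mulrA IH mulrA.
have evX i : v ^+ i * g = g * v' ^+ i.
  by elim: i => [|i IH]; rewrite ?expr0 ?mul1r ?mulr1 // !exprSr -mulrA ev mulrA IH mulrA.
have euv i j : u ^+ i * v ^+ j = g * (u' ^+ i * v' ^+ j) * g^-1.
  by rewrite mulrA -euX -[_ * g * _]mulrA -evX mulrA mulrK.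
have detx : \det (g * x * g^-1) = \det x.
  have udg : \det g \is a GRing.unit by rewrite -unitmxE.
  by rewrite !det_mulmx det_inv mulrAC (divrr udg) mul1r.
rewrite C1 C2 detx; split=> -[dx [i [j e]]]; split=> //; exists i, j.
  by rewrite euv e; reflexivity.
have := e; rewrite euv => h.
have : proj_eq (g^-1 * (g * x * g^-1) * g) (g^-1 * (g * (u' ^+ i * v' ^+ j) * g^-1) * g).
  by rewrite h; reflexivity.
by rewrite -!mulrA !mulKr // !mulrA !divrK.
Qed.

End Forward.

(** * The counterexample in degree divisible by a square *)

Section RankTwoPairs.
Variables (F : fieldType) (m : nat).
Local Notation M := 'M[F]_m.+1.

(** The images of [U] and [V] modulo scalars generate a copy of Z/p x Z/p; whether they commute as
    matrices is left open. *)
Record rank2_pair (p : nat) (U V : M) : Prop := Rank2Pair {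
  r2_unitU : U \is a GRing.unit;
  r2_unitV : V \is a GRing.unit;
  r2_expU : proj_eq (U ^+ p) 1;
  r2_expV : proj_eq (V ^+ p) 1;
  r2_comm : proj_eq (U * V) (V * U);
  r2_indep : forall i j, proj_eq (U ^+ i * V ^+ j) 1 -> (p %| i)%N /\ (p %| j)%N
}.

Variables (p : nat) (U V : M).
Hypothesis (p0 : (0 < p)%N) (r2 : rank2_pair p U V).

Lemma rank2_mul i j k l :
  proj_eq ((U ^+ i * V ^+ j) * (U ^+ k * V ^+ l)) (U ^+ (i + k) * V ^+ (j + l)).
Proof.
have [c c0 e] := r2_comm r2; have := weyl_expr k j e => h.
have {}h : proj_eq (V ^+ j * U ^+ k) (U ^+ k * V ^+ j).
  by apply: proj_eq_sym; rewrite h; apply: proj_eqZ; rewrite expf_neq0.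
rewrite !exprD -!mulrA [V ^+ j * (U ^+ k * _)]mulrA h -!mulrA.
by reflexivity.
Qed.

Lemma rank2_eq i j k l :
  proj_eq (U ^+ i * V ^+ j) (U ^+ k * V ^+ l) <-> i = k %[mod p] /\ j = l %[mod p].
Proof.
split=> [h|[ik jl]]; last first.
  by rewrite (proj_eqX_mod (r2_unitU r2) (r2_expU r2) ik)
     (proj_eqX_mod (r2_unitV r2) (r2_expV r2) jl); reflexivity.
have : proj_eq (U ^+ (i + (p * k - k)) * V ^+ (j + (p * l - l))) 1.
  rewrite -rank2_mul h rank2_mul !subnKC ?leq_pmull // !exprM.
  by rewrite (proj_eqX1 _ (r2_expU r2)) (proj_eqX1 _ (r2_expV r2)) mulr1; reflexivity.
have aux a b : (p %| a + (p * b - b))%N -> a = b %[mod p].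
  move=> /dvdnP[t et]; have e : (a + p * b = b + t * p)%N.
    by have := leq_pmull b p0; move: et; lia.
  by have := congr1 (modn^~ p) e; rewrite addnC mulnC modnMDl addnC modnMDl.
by move/(r2_indep r2) => [/aux h1 /aux h2].
Qed.

Lemma rank2_unit i j : U ^+ i * V ^+ j \is a GRing.unit.
Proof. by rewrite mul_unit ?unitrX ?(r2_unitU r2) ?(r2_unitV r2). Qed.

Lemma rank2_pair_scale (a b : F) : a != 0 -> b != 0 -> rank2_pair p (a *: U) (b *: V).
Proof.
move=> a0 b0; have [hU hV] := (proj_eqZ U a0, proj_eqZ V b0).
have sU : a *: U \is a GRing.unit.
  by rewrite scaler_unit ?unitfE // (r2_unitU r2).
have sV : b *: V \is a GRing.unit.
  by rewrite scaler_unit ?unitfE // (r2_unitV r2).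
split=> //.
- by rewrite (proj_eqX p hU); exact: (r2_expU r2).
- by rewrite (proj_eqX p hV); exact: (r2_expV r2).
- by rewrite hU hV; exact: (r2_comm r2).
- move=> i j h; apply: (r2_indep r2); rewrite -h (proj_eqX i hU) (proj_eqX j hV).
  by reflexivity.
Qed.

End RankTwoPairs.

(** * Isomorphism and non-conjugacy of rank-two groups *)

Section RankTwoIsomorphism.
Variables (F : closedFieldType) (m : nat).
Local Notation M := 'M[F]_m.+1.

Definition rank2_group (C : M -> Prop) (U V : M) : Prop :=
  forall x, C x <-> \det x = 1 /\ exists i j, proj_eq x (U ^+ i * V ^+ j).

Lemma rank2_group_scale p C U V : rank2_pair p U V -> rank2_group C U V ->
  exists U' V', [/\ rank2_pair p U' V', rank2_group C U' V', \det U' = 1, \det V' = 1 &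
    (proj_eq U U' /\ proj_eq V V')].
Proof.
move=> r2 gC; have [a a0 dU] := scale_to_det1 (r2_unitU r2).
have [b b0 dV] := scale_to_det1 (r2_unitV r2).
have [hU hV] := (proj_eqZ U a0, proj_eqZ V b0).
exists (a *: U), (b *: V); split=> //; first exact: rank2_pair_scale.
  move=> x; rewrite gC; split=> -[dx [i [j e]]]; split=> //; exists i, j; rewrite e.
    by rewrite (proj_eqX i hU) (proj_eqX j hV); reflexivity.
  by rewrite (proj_eqX i hU) (proj_eqX j hV); reflexivity.
by split; apply: proj_eq_sym.
Qed.

Lemma det_expr (A : M) k : \det A = 1 -> \det (A ^+ k) = 1.
Proof.
move=> dA; elim: k => [|k IH]; first by rewrite expr0 det1.
by rewrite exprS det_mulmx dA IH mulr1.
Qed.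

(** The isomorphism matches exponents: an element equal to U1^i V1^j up to a scalar goes to U2^i
    V2^j, where U2 and V2 are first rescaled into SL. *)
Lemma rank2_iso p C1 C2 U1 V1 U2 V2 : (0 < p)%N ->
  rank2_pair p U1 V1 -> rank2_pair p U2 V2 ->
  rank2_group C1 U1 V1 -> rank2_group C2 U2 V2 -> isoPSL C1 C2.
Proof.
move=> p0 r1 /rank2_group_scale s2 g1 /s2 {s2}[{}U2 [{}V2 [r2 g2 dU2 dV2 _]]].
pose N1 i j := U1 ^+ i * V1 ^+ j; pose N2 i j := U2 ^+ i * V2 ^+ j.
(* Being scalar is decidable, so the exponents below p are found by search. It succeeds on all of
   [C1]; the default 1 occurs only outside. *)
pose f x := if [pick ij : 'I_p * 'I_p | is_scalar_mx (x / N1 ij.1 ij.2)] is Some ij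
  then N2 ij.1 ij.2 else 1.
have dN2 i j : \det (N2 i j) = 1 by rewrite det_mulmx !det_expr ?mulr1.
have CN2 i j : C2 (N2 i j) by apply/g2; split=> //; exists i, j; reflexivity.
have d1 x : C1 x -> \det x = 1 by case/g1.
have d2 x : C2 x -> \det x = 1 by case/g2.
have C1M x y : C1 x -> C1 y -> C1 (x * y).
  move=> /g1[dx [i [j e]]] /g1[dy [k [l e']]]; apply/g1; split.
    by rewrite det_mulmx dx dy mulr1.
  by exists (i + k)%N, (j + l)%N; rewrite e e'; apply: rank2_mul r1 _ _ _ _.
have C2M x y : C2 x -> C2 y -> \det (x * y) = 1.
  by move=> /d2 dx /d2 dy; rewrite det_mulmx dx dy mulr1.
have fP x : C1 x -> exists i j, proj_eq x (N1 i j) /\ f x = N2 i j.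
  move=> Cx; have /g1[dx [i [j e]]] := Cx; rewrite /f.
  case: pickP => [ij /is_scalar_mxP[c ec]|no].
    exists ij.1, ij.2; split=> //; exists c.
      apply: contraTneq (oner_neq0 F) => c0.
      by rewrite -dx -(divrK (rank2_unit r1 ij.1 ij.2) x) ec c0 raddf0 mul0r det0 eqxx.
    by rewrite -[x in LHS](divrK (rank2_unit r1 ij.1 ij.2)) ec -mul_scalar_mx.
  have := no (Ordinal (ltn_pmod i p0), Ordinal (ltn_pmod j p0)); rewrite /=.
  suff [c c0 ->] : proj_eq x (N1 (i %% p)%N (j %% p)%N).
    move/is_scalar_mxP=> h; case: h; exists c.
    by rewrite -scalerAl (divrr (rank2_unit r1 _ _)) -scalemx1.
  by rewrite e; apply/(rank2_eq p0 r1); rewrite !modn_mod.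
have fC x : C1 x -> C2 (f x) by move=> /fP[i [j [_ ->]]].
exists f; split=> //.
- move=> x y Cx Cy /(modZE (d1 _ Cx) (d1 _ Cy)) xy; apply/(modZE (d2 _ (fC _ Cx)) (d2 _ (fC _ Cy))).
  have [[i [j [ex ->]]] [k [l [ey ->]]]] := (fP x Cx, fP y Cy).
  by apply/(rank2_eq p0 r2)/(rank2_eq p0 r1); rewrite -[U1 ^+ i * _]/(N1 i j) -ex xy.
- move=> x y Cx Cy; have Cxy := C1M _ _ Cx Cy.
  apply/(modZE (d2 _ (fC _ Cxy)) (C2M _ _ (fC _ Cx) (fC _ Cy))).
  have [[i [j [ex ->]]] [k [l [ey ->]]]] := (fP x Cx, fP y Cy).
  have [a [b [exy ->]]] := fP _ Cxy.
  rewrite (rank2_mul r2); apply/(rank2_eq p0 r2)/(rank2_eq p0 r1).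
  rewrite -[U1 ^+ a * _]/(N1 a b) -exy ex ey; exact: rank2_mul r1 _ _ _ _.
- move=> x y Cx Cy /(modZE (d2 _ (fC _ Cx)) (d2 _ (fC _ Cy))) h; apply/(modZE (d1 _ Cx) (d1 _ Cy)).
  have [[i [j [ex fx]]] [k [l [ey fy]]]] := (fP x Cx, fP y Cy).
  rewrite ex ey; apply/(rank2_eq p0 r1)/(rank2_eq p0 r2).
  by move: h; rewrite fx fy.
- move=> y Cy; have /g2[dy [i [j ey]]] := Cy.
  have u1 : N1 i j \is a GRing.unit := rank2_unit r1 i j.
  have [c c0 dc] := scale_to_det1 u1.
  have Cx : C1 (c *: N1 i j) by apply/g1; split=> //; exists i, j; apply: proj_eqZ.
  exists (c *: N1 i j) => //; apply/(modZE (d2 _ (fC _ Cx)) dy).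
  have [k [l [ex ->]]] := fP _ Cx.
  rewrite ey; apply/(rank2_eq p0 r2)/(rank2_eq p0 r1).
  by rewrite -[U1 ^+ k * _]/(N1 k l) -ex; apply: proj_eqZ.
Qed.

(** Commutativity of the full preimage in SL is invariant under conjugation; [C2] is commutative,
    whereas [C1] contains multiples of U1 and V1. *)
Lemma rank2_not_conj p C1 C2 U1 V1 U2 V2 :
  rank2_pair p U1 V1 -> rank2_group C1 U1 V1 -> rank2_group C2 U2 V2 ->
  U1 * V1 <> V1 * U1 -> U2 * V2 = V2 * U2 -> ~ conjPSL C1 C2.
Proof.
move=> /rank2_group_scale s1 /s1[U [V [r1 g1 dU dV [[a a0 eU] [b b0 eV]]]]] g2 nc1 c2 [g dg cg].
have ug := det_unit dg.
have cC x y : C2 x -> C2 y -> x * y = y * x.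
  move=> /g2[_ [i [j [c c0 ->]]]] /g2[_ [k [l [d e0 ->]]]].
  have h i' j' : GRing.comm (U2 ^+ i' * V2 ^+ j') U2.
    by apply: commr_sym; apply: commrM; [exact: commrX | apply: commrX].
  have h' i' j' : GRing.comm (U2 ^+ i' * V2 ^+ j') V2.
    by apply: commr_sym; apply: commrM; apply: commrX.
  rewrite -!scalerAl -!scalerAr !scalerA mulrC; congr (_ *: _).
  by apply: commrM; apply: commrX.
have CUV x : \det x = 1 -> (exists i j, x = U ^+ i * V ^+ j) -> C2 (g * x * g^-1).
  move=> dx [i [j ex]]; apply/cg; rewrite -[invmx g]/(g^-1) -[_ *m _ *m _]/(g^-1 * _ * g).
  rewrite -!mulrA mulVr // mulr1 mulKr //; apply/g1; split=> //.
  by exists i, j; rewrite ex; reflexivity.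
apply: nc1; rewrite eU eV -!scalerAl -!scalerAr !scalerA mulrC; congr (_ *: _).
have := cC _ _ (CUV U dU _) (CUV V dV _); rewrite -!mulrA !mulKr //.
move=> h; have {}h : g * (U * (V * g^-1)) = g * (V * (U * g^-1)).
  by apply: h; [exists 1%N, 0%N | exists 0%N, 1%N]; rewrite expr1 expr0 ?mulr1 ?mul1r.
have ugV : g^-1 \is a GRing.unit by rewrite unitrV.
by move/(mulrI ug): h; rewrite !mulrA => /(mulIr ugV).
Qed.

End RankTwoIsomorphism.

(** * Rank-two groups as double centralizers *)

Section DoubleCentralizer.
Variables (F : closedFieldType) (m : nat).
Hypothesis charF0 : [pchar F] =i pred0.
Local Notation M := 'M[F]_m.+1.

Lemma centPSL_subgroup (S : M -> Prop) : (forall A, S A -> A \is a GRing.unit) ->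
  subgroupPSL (centPSL S).
Proof.
move=> uS; split; first split.
- apply/(centPSLP _ uS); split; first exact: det1.
  by move=> A _; rewrite mul1r mulr1; reflexivity.
- by move=> A [].
- move=> A B /(centPSLP _ uS)[dA cA] /(centPSLP _ uS)[dB cB]; apply/(centPSLP _ uS).
  split; first by rewrite det_mulmx dA dB mulr1.
  move=> X SX; rewrite -[A *m B]/(A * B) -mulrA (cB X SX) !mulrA (cA X SX).
  by reflexivity.
- move=> A /(centPSLP _ uS)[dA cA]; apply/(centPSLP _ uS).
  split; first by rewrite det_inv dA invr1.
  move=> X SX; rewrite -[invmx A]/(A^-1).
  have [c c0 e] := cA X SX; apply: proj_eq_sym; exists c => //.
  exact: (comm_inv_scale (det_unit dA) e).
- move=> A [z [-> dA]]; apply/(centPSLP _ uS); split=> // X SX.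
  rewrite -[_%:M * X]/(_%:M *m X) -[X * _]/(X *m _%:M) scalar_mxC.
  by reflexivity.
Qed.

Variables (p : nat) (zeta : F) (U V W1 W2 : M).
Hypotheses (pp : prime p) (pzeta : p.-primitive_root zeta).
Hypotheses (uU : U \is a GRing.unit) (uV : V \is a GRing.unit).
Hypotheses (uW1 : W1 \is a GRing.unit) (uW2 : W2 \is a GRing.unit).
Hypothesis UV : proj_eq (U * V) (V * U).
Hypotheses (Up : proj_eq (U ^+ p) 1) (Vp : proj_eq (V ^+ p) 1).
Hypotheses (W1p : proj_eq (W1 ^+ p) 1) (W2p : proj_eq (W2 ^+ p) 1).
Hypotheses (W1U : W1 * U = zeta *: (U * W1)) (W1V : W1 * V = V * W1).
Hypotheses (W2U : W2 * U = U * W2) (W2V : W2 * V = zeta *: (V * W2)).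
Hypothesis irr : irreducibleSL (fun A : M => A = W1 \/ A = W2 \/
  [/\ A * A = A, A * U = U * A & A * V = V * A]).

(** Its centralizer H contains multiples of [W1] and [W2], whose commutators with U and V read off
    the exponents i and j of U^i V^j, and of 1 + E for idempotents E commuting with U and V. *)
Definition pair_pred (A : M) := A = U \/ A = V.

Let uS A : pair_pred A -> A \is a GRing.unit.
Proof. by case=> ->. Qed.

Local Notation H := (centPSL pair_pred).

Let subH A : H A -> \det A = 1. Proof. by case. Qed.

Let uH A : H A -> A \is a GRing.unit. Proof. by move/subH/det_unit. Qed.

Let zeta0 : zeta != 0.
Proof. by rewrite (prim_root_eq0 pzeta) -lt0n prime_gt0. Qed.

(** A scalar U^i V^j commutes with W1 and W2, which gives zeta^i = 1 and zeta^j = 1. *)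
Lemma dual_rank2_pair : rank2_pair p U V.
Proof.
split=> // i j h.
have uN : U ^+ i * V ^+ j \is a GRing.unit by rewrite mul_unit ?unitrX.
have e1 := weyl_expr 1 i W1U; have e2 := weyl_expr 1 j W2V.
rewrite mul1n !expr1 in e1; rewrite mul1n !expr1 in e2.
split; rewrite (prim_order_dvd pzeta); apply/eqP.
- have : (zeta ^+ i) *: ((U ^+ i * V ^+ j) * W1) = 1 *: ((U ^+ i * V ^+ j) * W1).
    rewrite scale1r [in RHS](proj_eq1_comm W1 h) [RHS]mulrA e1 -scalerAl -!mulrA.
    by rewrite (commrX j (W1V : GRing.comm W1 V)).
  by apply: scale_unit_inj; rewrite mul_unit.
- have : (zeta ^+ j) *: ((U ^+ i * V ^+ j) * W2) = 1 *: ((U ^+ i * V ^+ j) * W2).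
    rewrite scale1r [in RHS](proj_eq1_comm W2 h) [RHS]mulrA (commrX i (W2U : GRing.comm W2 U)).
    by rewrite -!mulrA e2 -scalerAr.
  by apply: scale_unit_inj; rewrite mul_unit.
Qed.

Lemma normalizer_scaled X : X \is a GRing.unit ->
  proj_eq (X * U) (U * X) -> proj_eq (X * V) (V * X) -> exists2 c, c != 0 & H (c *: X).
Proof.
move=> uX XU XV; have [c c0 dc] := scale_to_det1 uX; exists c => //.
apply/(centPSLP _ uS); split=> // A [] ->; rewrite (proj_eqZ X c0) //.
Qed.

Let HW1 : exists2 c, c != 0 & H (c *: W1).
Proof.
by apply: normalizer_scaled => //; [exists zeta | rewrite W1V; reflexivity].
Qed.

Let HW2 : exists2 c, c != 0 & H (c *: W2).
Proof.
by apply: normalizer_scaled => //; [rewrite W2U; reflexivity | exists zeta].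
Qed.

(* For an idempotent [E], [1 + E] is invertible, with inverse [1 - E / 2]. *)
Let HE E : E * E = E -> E * U = U * E -> E * V = V * E ->
  exists2 c, c != 0 & H (c *: (1 + E)).
Proof.
move=> EE EU EV; apply: normalizer_scaled.
- have h : (1 + E) * (1 - 2%:R^-1 *: E) = 1.
    have n2 := natr_neq0 charF0 (ltn0Sn 1).
    rewrite mulrDl mul1r mulrBr mulr1 -scalerAr EE -addrA -[RHS]addr0; congr (_ + _).
    have hE : E = 2%:R^-1 *: E + 2%:R^-1 *: E.
      rewrite -scalerDl; have -> : 2%:R^-1 + 2%:R^-1 = 1 :> F by field.
      by rewrite scale1r.
    by rewrite [X in X - _]hE addrK addNr.
  by have [] := mulmx1_unit h.
- by rewrite mulrDl mulrDr mul1r mulr1 EU; reflexivity.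
- by rewrite mulrDl mulrDr mul1r mulr1 EV; reflexivity.
Qed.

(** A subspace stable under 1 + E is stable under E, so H-stable subspaces are stable under the
    irreducible family of [irr]. *)
Lemma dual_irreducible : irreducibleSL H.
Proof.
move=> Y stY; apply: irr => A.
have st c X : c != 0 -> H (c *: X) -> (Y *m X <= Y)%MS.
  by move=> c0 /stY; rewrite -scalemxAr (eqmx_scale _ c0).
case=> [->|[->|[EE EU EV]]].
- by have [c c0 /(st _ _ c0)] := HW1.
- by have [c c0 /(st _ _ c0)] := HW2.
- have [c c0 /(st _ _ c0)] := HE EE EU EV.
  rewrite -[1 + A]/(1%:M + A) mulmxDr mulmx1 => h.
  have -> : Y *m A = (Y + Y *m A) - Y by rewrite addrC addKr.
  by rewrite addmx_sub ?eqmx_opp.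
Qed.

Let cent_normal g X c : centPSL H g -> c != 0 -> H (c *: X) -> proj_eq (g * X) (X * g).
Proof.
move=> /(centPSLP _ uH)[_ cg] c0 /cg; rewrite (proj_eqZ X c0); exact.
Qed.

(** By determinants, g commutes with 1 + E up to an (m+1)-th root of unity, hence exactly with (1 +
    E)^(m+1) = 1 + (2^(m+1) - 1) E, and so with E. *)
Let cent_idem g E : centPSL H g -> E * E = E -> E * U = U * E -> E * V = V * E ->
  g * E = E * g.
Proof.
move=> Cg EE EU EV; have [c c0 HX] := HE EE EU EV.
have [a a0 ea] := cent_normal Cg c0 HX.
have uX : 1 + E \is a GRing.unit.
  by have := uH HX; rewrite scaler_unit ?unitfE.
have an : a ^+ m.+1 = 1.
  have := congr1 determinant ea; rewrite detZ !det_mulmx (proj1 Cg : \det g = 1) mul1r mulr1.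
  have dX : \det (1 + E) \is a GRing.unit by rewrite -unitmxE.
  by rewrite -{1}[\det _]mul1r => /(mulIr dX).
have EX k : (1 + E) ^+ k = 1 + (2 ^ k - 1)%:R *: E.
  elim: k => [|k IH]; first by rewrite expr0 subnn scale0r addr0.
  rewrite exprS IH mulrDl mul1r mulrDr mulr1 -scalerAr EE -addrA; congr (_ + _).
  rewrite addrA -{2}[E]scale1r -!scalerDl; congr (_ *: _).
  by rewrite -[1]/(1%:R) -!natrD; congr (_%:R); have := expn_gt0 2 k; rewrite expnS; lia.
have := weyl_expr 1 m.+1 ea; rewrite mul1n !expr1 an scale1r EX.
rewrite mulrDr mulrDl mulr1 mul1r => /addrI; rewrite -scalerAr -scalerAl.
apply: scalerI; apply: natr_neq0 => //.
by have := ltn_expl m.+1 (isT : 1 < 2)%N; rewrite subn_gt0; apply: leq_ltn_trans.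
Qed.

(** An element g of the centralizer of H has the same commutators with W1 and W2 as some U^i V^j.
    The quotient commutes with W1, W2 and the idempotents, so it is scalar by Schur's lemma. *)
Lemma dual_centralizer : rank2_group (centPSL H) U V.
Proof.
move=> g; split=> [Cg|[dg [i [j e]]]]; last first.
  apply/(centPSLP _ uH); split=> // A /(centPSLP _ uS)[_ cA].
  have [cU cV] := (cA U (or_introl erefl), cA V (or_intror erefl)).
  have aux X k : proj_eq (A * X) (X * A) -> proj_eq (X ^+ k * A) (A * X ^+ k).
    case=> c c0 eX; have := weyl_expr 1 k eX; rewrite mul1n !expr1 => ->.
    by apply: proj_eq_sym; apply: proj_eqZ; rewrite expf_neq0.
  by rewrite e -mulrA (aux V j cV) !mulrA (aux U i cU) -!mulrA; reflexivity.
split; first by case: Cg.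
have ug : g \is a GRing.unit by case: Cg => /det_unit.
have pw X : X \is a GRing.unit -> proj_eq (X ^+ p) 1 -> (exists2 c, c != 0 & H (c *: X)) ->
    exists i : nat, X * g = zeta ^+ i *: (g * X).
  move=> uX Xp [c c0 HX]; have [a a0 ea] := proj_eq_sym (cent_normal Cg c0 HX).
  suff ap : a ^+ p = 1 by have [i ei] := prim_rootP pzeta ap; exists i; rewrite -ei.
  have := weyl_expr p 1 ea; rewrite muln1 !expr1 (proj_eq1_comm g Xp) => h.
  apply: (@scale_unit_inj _ _ _ _ (g * X ^+ p)); first by rewrite mul_unit ?unitrX.
  by rewrite -h scale1r.
have [i ei] := pw W1 uW1 W1p HW1; have [j ej] := pw W2 uW2 W2p HW2.
exists i, j; pose N := U ^+ i * V ^+ j.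
have uN : N \is a GRing.unit by rewrite mul_unit ?unitrX.
have e1 := weyl_expr 1 i W1U; have e2 := weyl_expr 1 j W2V.
rewrite mul1n !expr1 in e1; rewrite mul1n !expr1 in e2.
have N1 : W1 * N = zeta ^+ i *: (N * W1).
  by rewrite /N mulrA e1 -scalerAl -!mulrA (commrX j (W1V : GRing.comm W1 V)).
have N2 : W2 * N = zeta ^+ j *: (N * W2).
  by rewrite /N mulrA (commrX i (W2U : GRing.comm W2 U)) -!mulrA e2 -scalerAr.
have key X k : X * g = zeta ^+ k *: (g * X) -> X * N = zeta ^+ k *: (N * X) ->
    (g / N) * X = X * (g / N).
  move=> Xg XN; have zk : zeta ^+ k != 0 by rewrite expf_neq0.
  have NX : N * X = (zeta ^+ k)^-1 *: (X * N) by rewrite XN scalerA mulVf // scale1r.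
  rewrite [RHS]mulrA Xg -scalerAl -[in RHS]mulrA (comm_inv_scale uN NX).
  by rewrite -scalerAr scalerA mulfV // scale1r mulrA.
suff h : proj_eq (g / N) 1 by rewrite -[g](divrK uN) h mul1r; reflexivity.
apply: (schur_unit irr); first by rewrite mul_unit ?unitrV.
move=> A [->|[->|[EE EU EV]]]; [exact: (key _ i)|exact: (key _ j)|].
have cN : GRing.comm A N by apply: commrM; apply: commrX.
by rewrite -mulrA -(commrV cN) !mulrA (cent_idem Cg).
Qed.

End DoubleCentralizer.

(** * Matrices indexed by a finite type *)

Section IndexedMatrices.
Variables (F : fieldType) (m : nat) (T : finType) (ev : 'I_m.+1 -> T) (iv : T -> 'I_m.+1).
Hypotheses (evK : cancel ev iv) (ivK : cancel iv ev).
Local Notation M := 'M[F]_m.+1.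

Definition tmx (K : T -> T -> F) : M := \matrix_(i, j) K (ev i) (ev j).

Lemma eq_tmx K L : K =2 L -> tmx K = tmx L.
Proof. by move=> KL; apply/matrixP => i j; rewrite !mxE. Qed.

Lemma tmxM K L : tmx K * tmx L = tmx (fun x y => \sum_t K x t * L t y).
Proof.
apply/matrixP => i j; rewrite !mxE (reindex ev) /=; last by exists iv => t _.
by apply: eq_bigr => k _; rewrite !mxE.
Qed.

Lemma tmxZ c K : c *: tmx K = tmx (fun x y => c * K x y).
Proof. by apply/matrixP => i j; rewrite !mxE. Qed.

Lemma tmx1 : 1 = tmx (fun x y => (y == x)%:R).
Proof.
by apply/matrixP => i j; rewrite !mxE (can_eq evK) eq_sym.
Qed.

Lemma sum_delta (z : T) (G : T -> F) : \sum_t (t == z)%:R * G t = G z.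
Proof.
rewrite (bigD1 z) //= eqxx mul1r big1 ?addr0 // => t /negPf ->.
by rewrite mul0r.
Qed.

Definition tdiag (c : T -> F) : M := tmx (fun x y => (y == x)%:R * c x).
(** Acting on row vectors, it sends the basis vector of x to that of f x. *)
Definition tmap (f : T -> T) : M := tmx (fun x y => (y == f x)%:R).
Definition tdelta (x z : T) : M := tmx (fun u v => (u == x)%:R * (v == z)%:R).

Lemma tdiagM c K : tdiag c * tmx K = tmx (fun x y => c x * K x y).
Proof.
rewrite tmxM; apply: eq_tmx => x y.
by under eq_bigr do rewrite -mulrA; rewrite sum_delta.
Qed.

Lemma tmxMdiag c K : tmx K * tdiag c = tmx (fun x y => K x y * c y).
Proof.
rewrite tmxM; apply: eq_tmx => x y; rewrite -[RHS](sum_delta y (fun t => K x t * c t)).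
by apply: eq_bigr => t _; rewrite mulrCA eq_sym.
Qed.

Lemma tmapM f K : tmap f * tmx K = tmx (fun x y => K (f x) y).
Proof. by rewrite tmxM; apply: eq_tmx => x y; rewrite sum_delta. Qed.

Lemma tmxMmap f g K : cancel f g -> cancel g f ->
  tmx K * tmap f = tmx (fun x y => K x (g y)).
Proof.
move=> fK gK; rewrite tmxM; apply: eq_tmx => x y; rewrite -[RHS](sum_delta (g y)).
by apply: eq_bigr => t _; rewrite mulrC -(can2_eq gK fK) eq_sym.
Qed.

Lemma tdelta_map x z f : tdelta x z * tmap f = tdelta x (f z).
Proof.
rewrite tmxM; apply: eq_tmx => u v; under eq_bigr do rewrite -mulrA.
by rewrite -mulr_sumr sum_delta.
Qed.

Lemma tdiag_mul c d : tdiag c * tdiag d = tdiag (fun x => c x * d x).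
Proof. by rewrite tdiagM; apply: eq_tmx => x y; rewrite mulrCA. Qed.

Lemma tdiagX c k : tdiag c ^+ k = tdiag (fun x => c x ^+ k).
Proof.
elim: k => [|k IH]; first by rewrite expr0 tmx1; apply: eq_tmx => x y; rewrite expr0 mulr1.
by rewrite exprS IH tdiag_mul; apply: eq_tmx => x y; rewrite exprS.
Qed.

Lemma tmapX f k : tmap f ^+ k = tmap (iter k f).
Proof.
elim: k => [|k IH]; first by rewrite expr0 tmx1.
by rewrite exprS IH tmapM; apply: eq_tmx => x y; rewrite -iterSr.
Qed.

Lemma expr1_unit (A : M) k : (0 < k)%N -> A ^+ k = 1 -> A \is a GRing.unit.
Proof.
move=> k0 Ak; have h : A *m A ^+ k.-1 = 1%:M.
  by rewrite -[LHS]/(A * A ^+ k.-1) -exprS prednK.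
by have [] := mulmx1_unit h.
Qed.

Section Stability.
Variable Y : M.

Lemma stablemxZ c (A : M) : stablemx Y A -> stablemx Y (c *: A).
Proof. by move=> sA; rewrite -scalemxAr scalemx_sub. Qed.

Lemma stablemxX (A : M) k : stablemx Y A -> stablemx Y (A ^+ k).
Proof.
move=> sA; elim: k => [|k IH]; first by rewrite expr0; apply: stablemxC.
by rewrite exprS; apply: stablemxM.
Qed.

Lemma stablemx_sumr I (r : seq I) (G : I -> M) :
  (forall i, stablemx Y (G i)) -> stablemx Y (\sum_(i <- r) G i).
Proof.
move=> sG; elim/big_rec: _ => [|i A _ sA]; first exact: stablemx0.
exact: stablemxD.
Qed.

Lemma stablemx_addKl (A B : M) : stablemx Y A -> stablemx Y (A + B) -> stablemx Y B.
Proof.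
move=> sA sAB; have -> : B = (A + B) + (-1) *: A by rewrite scaleN1r addrC addKr.
by apply: stablemxD => //; apply: stablemxZ.
Qed.

(** A row of Y with a nonzero entry is carried by matrix units to multiples of every basis
    vector. *)
Lemma stablemx_deltas : (forall x z, stablemx Y (tdelta x z)) -> Y = 0 \/ row_full Y.
Proof.
move=> sE; case: (eqVneq Y 0) => [|Y0]; [by left | right].
have /matrix0Pn[i [j Yij]] := Y0.
rewrite -sub1mx; apply/row_subP => k; rewrite row1.
have -> : delta_mx 0 k = (Y i j)^-1 *: (row i Y *m tdelta (ev j) (ev k)).
  apply/rowP => l; rewrite !mxE /= (bigD1 j) //= big1 => [|t tj]; rewrite !mxE.
    by rewrite eqxx mul1r addr0 mulrA mulVf // mul1r (can_eq evK).
  by rewrite (can_eq evK) (negPf tj) mul0r mulr0.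
by apply: scalemx_sub; apply: submx_trans (submxMr _ (row_sub i Y)) (sE _ _).
Qed.

End Stability.

End IndexedMatrices.

Lemma val_iter_ordS n k (i : 'I_n) : iter k (@ordS n) i = ((i + k) %% n)%N :> nat.
Proof.
elim: k => [|k IH]; first by rewrite addn0 modn_small.
by rewrite /= IH addnS -[(_ %% n).+1]addn1 modnDml addn1.
Qed.

Lemma iter_ordS_id n (i : 'I_n) : iter n (@ordS n) i = i.
Proof. by apply/ord_inj; rewrite val_iter_ordS modnDr modn_small. Qed.

Lemma iter_ordS_trans n (i j : 'I_n) : exists k, iter k (@ordS n) i = j.
Proof.
exists (n - i + j)%N; apply/ord_inj; rewrite val_iter_ordS addnA subnKC ?(ltnW (ltn_ord i)) //.
by rewrite modnDl modn_small.
Qed.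

Lemma prim_expr_ordS (F : fieldType) n (z : F) (i : 'I_n) : n.-primitive_root z ->
  z ^+ ordS i = z * z ^+ i.
Proof. by move=> pz; rewrite /= (prim_expr_mod pz) exprS. Qed.

Lemma sum_unity_root (F : fieldType) p (w : F) : w ^+ p = 1 ->
  \sum_(0 <= t < p) w ^+ t = if w == 1 then p%:R else 0.
Proof.
move=> wp; case: eqP => [->|/eqP w1].
  by under eq_bigr do rewrite expr1n; rewrite sumr_const_nat subn0.
have : (w - 1) * \sum_(0 <= t < p) w ^+ t = 0 by rewrite big_mkord -subrX1 wp subrr.
by move/eqP; rewrite mulf_eq0 subr_eq0 (negPf w1) => /eqP.
Qed.

(** * The noncommuting pair: clock and shift on the first tensor factor *)

Section HeisenbergModel.
Variables (F : closedFieldType) (m : nat) (p : nat) (B : finType).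
Local Notation T := ('I_p * B)%type.
Variables (ev : 'I_m.+1 -> T) (iv : T -> 'I_m.+1).
Hypotheses (evK : cancel ev iv) (ivK : cancel iv ev).
Hypothesis charF0 : [pchar F] =i pred0.
Variable zeta : F.
Hypotheses (pp : prime p) (pz : p.-primitive_root zeta).
Local Notation M := 'M[F]_m.+1.

Definition shift1 (x : T) : T := (ordS x.1, x.2).
Definition unshift1 (x : T) : T := (ord_pred x.1, x.2).
Definition clock1 : M := tdiag ev (fun x => zeta ^+ x.1).
(** The inverse of the clock; the inversion gives its commutation with the shift the factor zeta
    required of [W2]. *)
Definition clock1V : M := tdiag ev (fun x => zeta ^- x.1).
Definition shift1_mx : M := tmap F ev shift1.

Lemma shift1K : cancel shift1 unshift1.
Proof. by case=> a b; rewrite /unshift1 /= ordSK. Qed.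

Lemma unshift1K : cancel unshift1 shift1.
Proof. by case=> a b; rewrite /shift1 /= ord_predK. Qed.

Lemma iter_shift1 k x : iter k shift1 x = (iter k (@ordS p) x.1, x.2).
Proof. by elim: k => [|k IH] /=; [case: x | rewrite IH]. Qed.

Let p0 : (0 < p)%N := prime_gt0 pp.
Let zeta0 : zeta != 0. Proof. by rewrite (prim_root_eq0 pz) -lt0n. Qed.

Lemma clock1_exp : clock1 ^+ p = 1.
Proof.
rewrite /clock1 (tdiagX evK ivK) (tmx1 F evK); apply: eq_tmx => x y.
by rewrite -exprM mulnC exprM (prim_expr_order pz) expr1n mulr1.
Qed.

Lemma clock1V_exp : clock1V ^+ p = 1.
Proof.
rewrite /clock1V (tdiagX evK ivK) (tmx1 F evK); apply: eq_tmx => x y.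
by rewrite exprVn -exprM mulnC exprM (prim_expr_order pz) expr1n invr1 mulr1.
Qed.

Lemma shift1_exp : shift1_mx ^+ p = 1.
Proof.
rewrite /shift1_mx (tmapX F evK ivK) (tmx1 F evK); apply: eq_tmx => x y.
by rewrite iter_shift1 iter_ordS_id; case: x.
Qed.

Lemma shift1_clock1 : shift1_mx * clock1 = zeta *: (clock1 * shift1_mx).
Proof.
rewrite /shift1_mx /clock1 {1}/tdiag (tmapM evK ivK) (tdiagM evK ivK) tmxZ.
apply: eq_tmx => x y /=.
by rewrite (prim_expr_mod pz) exprS; ring.
Qed.

Lemma clock1V_shift1 : clock1V * shift1_mx = zeta *: (shift1_mx * clock1V).
Proof.
rewrite /shift1_mx /clock1V {2}/tdiag (tmapM evK ivK) (tdiagM evK ivK) tmxZ.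
apply: eq_tmx => x y /=.
have zx : zeta ^+ x.1 != 0 by rewrite expf_neq0.
by rewrite (prim_expr_mod pz) exprS; field; rewrite zx zeta0.
Qed.

(** The identity of F^p tensored with a matrix unit on the second factor. *)
Definition block_unit (y y' : B) : M :=
  tmx ev (fun u v => (u.1 == v.1)%:R * (u.2 == y)%:R * (v.2 == y')%:R).

Lemma block_unitM y y' z z' :
  block_unit y y' * block_unit z z' = (y' == z)%:R *: block_unit y z'.
Proof.
rewrite /block_unit (tmxM evK ivK) tmxZ; apply: eq_tmx => u v.
rewrite (bigD1 (u.1, y')) //= big1 ?addr0.
  by rewrite !eqxx !mul1r mulr1; ring.
move=> [a b]; rewrite xpair_eqE negb_and /= eq_sym => /orP[] /negPf -> ; last by rewrite mulr0 mul0r.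
by rewrite !mul0r.
Qed.

Lemma block_unit_clock1 y y' : block_unit y y' * clock1 = clock1 * block_unit y y'.
Proof.
rewrite /clock1 (tdiagM evK ivK) (tmxMdiag evK ivK); apply: eq_tmx => u v /=.
by case: eqP => [->|_]; rewrite ?mul0r ?mulr0 // mulrC.
Qed.

Lemma block_unit_shift1 y y' : block_unit y y' * shift1_mx = shift1_mx * block_unit y y'.
Proof.
rewrite /shift1_mx (tmapM evK ivK) (tmxMmap evK ivK _ shift1K unshift1K); apply: eq_tmx => u v /=.
by rewrite -(can2_eq (@ordSK p) (@ord_predK p)).
Qed.

(** Clock projectors, block units and powers of the shift multiply to all matrix units, so a stable
    subspace is trivial. *)
Lemma heisenberg_irreducible : irreducibleSL (fun A : M =>
  A = shift1_mx \/ A = clock1V \/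
  [/\ A * A = A, A * clock1 = clock1 * A & A * shift1_mx = shift1_mx * A]).
Proof.
move=> Y stY.
have sW1 : stablemx Y shift1_mx by apply: stY; left.
have sW2 : stablemx Y clock1V by apply: stY; right; left.
have sD y : stablemx Y (block_unit y y).
  apply: stY; right; right; split; [|exact: block_unit_clock1|exact: block_unit_shift1].
  by rewrite block_unitM eqxx scale1r.
have sB y y' : stablemx Y (block_unit y y').
  case: (eqVneq y y') => [<-|yy']; first exact: sD.
  (* An off-diagonal block unit is not idempotent, but its sum with the diagonal block unit of the
     same row is. *)
  apply: stablemx_addKl (sD y) _; apply: stY; right; right; split.
  - rewrite mulrDl !mulrDr !block_unitM eqxx [y' == y]eq_sym (negPf yy').
    by rewrite !scale0r !scale1r !addr0.
  - by rewrite mulrDl mulrDr !block_unit_clock1.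
  - by rewrite mulrDl mulrDr !block_unit_shift1.
apply: (stablemx_deltas evK) => -[a y] [b y'].
have [k <-] := iter_ordS_trans a b.
have -> : (iter k (@ordS p) a, y') = iter k shift1 (a, y') by rewrite iter_shift1.
rewrite -(tdelta_map F evK ivK) -(tmapX F evK ivK); apply: stablemxM; last exact: stablemxX.
(* the spectral projector of the clock onto its [a]-th eigenspace *)
have -> : tdelta F ev (a, y) (a, y') =
    cyc_proj p (zeta ^+ a *: clock1V) * block_unit y y'.
  rewrite /cyc_proj.
  under eq_bigr => i _ do rewrite exprZn /clock1V (tdiagX evK ivK).
  rewrite -scalerAl mulr_suml.
  under eq_bigr => i _ do rewrite -scalerAl /block_unit (tdiagM evK ivK) tmxZ.
  apply/matrixP => i j; rewrite !mxE summxE.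
  under eq_bigr => t _ do rewrite mxE.
  set u := ev i; set v := ev j; rewrite -!pair_eqE /pair_eq /=.
  rewrite (eq_bigr (fun t => (zeta ^+ a / zeta ^+ u.1) ^+ t *
    ((u.1 == v.1)%:R * (u.2 == y)%:R * (v.2 == y')%:R))); last first.
    by move=> t _; rewrite exprMn mulrA.
  rewrite -mulr_suml sum_unity_root; last first.
    by rewrite exprMn exprVn -!exprM ![(_ * p)%N]mulnC !(exprM _ p) (prim_expr_order pz)
      !expr1n divr1.
  have zu0 : zeta ^+ u.1 != 0 by rewrite expf_neq0.
  have -> : (zeta ^+ a / zeta ^+ u.1 == 1) = (u.1 == a).
    rewrite -[X in _ == X](divff zu0) (inj_eq (mulIf (invr_neq0 zu0))).
    by rewrite (eq_prim_root_expr pz) !modn_small // eq_sym.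
  have [<-|_] := eqVneq u.1 a; last by rewrite !mul0r mulr0.
  rewrite [u.1 == v.1]eq_sym [p%:R^-1 * _]mulrA mulVf ?natr_neq0 // mul1r /=.
  by case: (u.2 == y); case: (v.1 == u.1); case: (v.2 == y'); rewrite /= ?(mulr0, mul0r, mulr1).
apply: stablemxM => //; apply: stablemxZ; apply: stablemx_sumr => i; apply: stablemxX.
exact: stablemxZ.
Qed.

End HeisenbergModel.

(** * The commuting pair: clocks on the first two tensor factors *)

Section TorusModel.
Variables (F : closedFieldType) (m : nat) (p : nat) (K : finType).
Local Notation T := ('I_p * ('I_p * K))%type.
Variables (ev : 'I_m.+1 -> T) (iv : T -> 'I_m.+1).
Hypotheses (evK : cancel ev iv) (ivK : cancel iv ev).
Variable zeta : F.
Hypotheses (pp : prime p) (pz : p.-primitive_root zeta).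
Local Notation M := 'M[F]_m.+1.
Local Notation clock1 := (clock1 ev zeta).
Local Notation shift1_mx := (shift1_mx F ev).

Definition shift2 (x : T) : T := (x.1, (ordS x.2.1, x.2.2)).
Definition clock2 : M := tdiag ev (fun x : T => zeta ^+ x.2.1).
Definition shift2_mx : M := tmap F ev shift2.

Lemma iter_shift2 k x : iter k shift2 x = (x.1, (iter k (@ordS p) x.2.1, x.2.2)).
Proof. by elim: k => [|k IH] /=; [case: x => a [] | rewrite IH]. Qed.

Lemma clock2_exp : clock2 ^+ p = 1.
Proof.
rewrite /clock2 (tdiagX evK ivK) (tmx1 F evK); apply: eq_tmx => x y.
by rewrite -exprM mulnC exprM (prim_expr_order pz) expr1n mulr1.
Qed.

Lemma shift2_exp : shift2_mx ^+ p = 1.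
Proof.
rewrite /shift2_mx (tmapX F evK ivK) (tmx1 F evK); apply: eq_tmx => x y.
by rewrite iter_shift2 iter_ordS_id; case: x => a [].
Qed.

Lemma tdiag_comm (c d : T -> F) : tdiag ev c * tdiag ev d = tdiag ev d * tdiag ev c.
Proof. by rewrite !(tdiag_mul evK ivK); apply: eq_tmx => x y; rewrite [c x * _]mulrC. Qed.

Lemma shift_clock (f : T -> T) (c : T -> F) a : (forall x, c (f x) = a * c x) ->
  tmap F ev f * tdiag ev c = a *: (tdiag ev c * tmap F ev f).
Proof.
move=> cf; rewrite /tmap {1}/tdiag (tmapM evK ivK) (tdiagM evK ivK) tmxZ.
by apply: eq_tmx => x y /=; rewrite cf; ring.
Qed.

Lemma shift1_clock2 : shift1_mx * clock2 = clock2 * shift1_mx.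
Proof. by rewrite -[RHS]scale1r; apply: shift_clock => x; rewrite mul1r. Qed.

Lemma shift2_clock1 : shift2_mx * clock1 = clock1 * shift2_mx.
Proof. by rewrite -[RHS]scale1r; apply: shift_clock => x; rewrite mul1r. Qed.

Lemma shift2_clock2 : shift2_mx * clock2 = zeta *: (clock2 * shift2_mx).
Proof. by apply: shift_clock => x; rewrite (prim_expr_ordS _ pz). Qed.

Lemma tdeltaM (x z x' z' : T) : tdelta F ev x z * tdelta F ev x' z' =
  (z == x')%:R *: tdelta F ev x z'.
Proof.
rewrite /tdelta (tmxM evK ivK) tmxZ; apply: eq_tmx => u v.
under eq_bigr do rewrite -mulrA.
by rewrite -mulr_sumr sum_delta; ring.
Qed.

Lemma tdelta_diag (c : T -> F) x z : c x = c z ->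
  tdelta F ev x z * tdiag ev c = tdiag ev c * tdelta F ev x z.
Proof.
move=> cxz; rewrite /tdelta (tdiagM evK ivK) (tmxMdiag evK ivK); apply: eq_tmx => u v.
have [->|_] := eqVneq u x; last by rewrite !mul0r mulr0.
have [->|_] := eqVneq v z; last by rewrite !mulr0 mul0r.
by rewrite cxz !mul1r mulr1.
Qed.

(** Matrix units between indices with equal first two coordinates commute with both clocks; the two
    shifts then change these coordinates arbitrarily. *)
Lemma torus_irreducible : irreducibleSL (fun A : M =>
  A = shift1_mx \/ A = shift2_mx \/
  [/\ A * A = A, A * clock1 = clock1 * A & A * clock2 = clock2 * A]).
Proof.
move=> Y stY.
have sW1 : stablemx Y shift1_mx by apply: stY; left.
have sW2 : stablemx Y shift2_mx by apply: stY; right; left.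
have sD x : stablemx Y (tdelta F ev x x).
  apply: stY; right; right; split; [|exact: tdelta_diag|exact: tdelta_diag].
  by rewrite tdeltaM eqxx scale1r.
have sB (x z : T) : x.1 = z.1 -> x.2.1 = z.2.1 -> stablemx Y (tdelta F ev x z).
  move=> e1 e2; case: (eqVneq x z) => [<-|xz]; first exact: sD.
  apply: stablemx_addKl (sD x) _; apply: stY; right; right; split.
  - rewrite mulrDl !mulrDr !tdeltaM eqxx [z == x]eq_sym (negPf xz).
    by rewrite !scale0r !scale1r !addr0.
  - by rewrite mulrDl mulrDr !tdelta_diag ?e1.
  - by rewrite mulrDl mulrDr !tdelta_diag ?e2.
apply: (stablemx_deltas evK) => -[a [b i]] [c [d j]].
have [k <-] := iter_ordS_trans a c; have [l <-] := iter_ordS_trans b d.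
have -> : (iter k (@ordS p) a, (iter l (@ordS p) b, j)) =
    iter k (@shift1 p _) (iter l shift2 (a, (b, j))).
  by rewrite iter_shift1 iter_shift2.
rewrite -!(tdelta_map F evK ivK) -!(tmapX F evK ivK).
by apply: stablemxM; [apply: stablemxM; [exact: sB | exact: stablemxX] | exact: stablemxX].
Qed.

End TorusModel.

(** * The counterexample and the equivalence *)

Lemma index_bijection m (T : finType) : #|T| = m.+1 ->
  exists ev : 'I_m.+1 -> T, exists2 iv : T -> 'I_m.+1, cancel ev iv & cancel iv ev.
Proof.
move=> cT; exists (fun i => enum_val (cast_ord (esym cT) i)).
exists (fun x => cast_ord cT (enum_rank x)) => x.
  by rewrite enum_valK cast_ordKV.
by rewrite cast_ordK enum_rankK.
Qed.

Lemma nonsquarefree_counterexample (F : closedFieldType) m p :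
  [pchar F] =i pred0 -> prime p -> (p * p %| m.+1)%N ->
  exists H1 H2 : 'M[F]_m.+1 -> Prop,
    [/\ subgroupPSL H1 /\ subgroupPSL H2, irreducibleSL H1 /\ irreducibleSL H2,
        isoPSL (centPSL H1) (centPSL H2) & ~ conjPSL (centPSL H1) (centPSL H2)].
Proof.
move=> charF0 pp /dvdnP[k mk]; have p0 := prime_gt0 pp.
have [zeta pz] := exists_primitive_root charF0 p0.
(* This index set realizes F^n as the tensor product of F^p, F^p and F^k, with n = k p^2. *)
have cT : #|{: 'I_p * ('I_p * 'I_k)}| = m.+1 by rewrite !card_prod !card_ord mk; lia.
have [ev [iv evK ivK]] := index_bijection cT.
pose U := clock1 ev zeta; pose V1 := shift1_mx F ev; pose V2 := clock2 ev zeta.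
pose U' := clock1V ev zeta; pose S2 := shift2_mx F ev.
have Up : U ^+ p = 1 by apply: clock1_exp evK ivK _ _.
have U'p : U' ^+ p = 1 by apply: clock1V_exp evK ivK _ _.
have V1p : V1 ^+ p = 1 by apply: shift1_exp evK ivK.
have V2p : V2 ^+ p = 1 by apply: clock2_exp evK ivK _ _.
have S2p : S2 ^+ p = 1 by apply: shift2_exp evK ivK.
have uU := expr1_unit p0 Up; have uU' := expr1_unit p0 U'p.
have uV1 := expr1_unit p0 V1p; have uV2 := expr1_unit p0 V2p.
have uS2 := expr1_unit p0 S2p.
have one (A : 'M[F]_m.+1) : A ^+ p = 1 -> proj_eq (A ^+ p) 1 by move->; reflexivity.
have zeta0 : zeta != 0 by rewrite (prim_root_eq0 pz) -lt0n.
have W1U : V1 * U = zeta *: (U * V1) by apply: shift1_clock1 evK ivK _ _.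
have UV1 : proj_eq (U * V1) (V1 * U) by apply: proj_eq_sym; exists zeta.
have UV2c : U * V2 = V2 * U by apply: tdiag_comm.
have UV2 : proj_eq (U * V2) (V2 * U) by rewrite UV2c; reflexivity.
have U'U : U' * U = U * U' by apply: tdiag_comm.
have U'V1 : U' * V1 = zeta *: (V1 * U') by apply: clock1V_shift1 evK ivK _ _ _.
have V1V2 : V1 * V2 = V2 * V1 by apply: shift1_clock2 evK ivK _.
have S2U : S2 * U = U * S2 by apply: shift2_clock1 evK ivK _.
have S2V2 : S2 * V2 = zeta *: (V2 * S2) by apply: shift2_clock2 evK ivK _ _.
have irr1 := heisenberg_irreducible evK ivK charF0 pp pz.
have irr2 := torus_irreducible (zeta := zeta) evK ivK.
(* The dual pair consists of the shift and the inverse clock in the noncommuting case, and of the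
   two shifts in the commuting case. *)
have r1 := dual_rank2_pair pz uU uV1 uV1 uU' UV1 (one _ Up) (one _ V1p) W1U erefl U'U U'V1.
have r2 := dual_rank2_pair pz uU uV2 uV1 uS2 UV2 (one _ Up) (one _ V2p) W1U V1V2 S2U S2V2.
have g1 := dual_centralizer charF0 pp pz uU uV1 uV1 uU' (one _ V1p) (one _ U'p)
  W1U erefl U'U U'V1 irr1.
have g2 := dual_centralizer charF0 pp pz uU uV2 uV1 uS2 (one _ V1p) (one _ S2p)
  W1U V1V2 S2U S2V2 irr2.
exists (centPSL (pair_pred U V1)), (centPSL (pair_pred U V2)); split.
- by split; apply: centPSL_subgroup => A [] ->.
- split; first exact: (dual_irreducible charF0 pp pz uU uV1 uV1 uU' W1U erefl U'U U'V1 irr1).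
  exact: (dual_irreducible charF0 pp pz uU uV2 uV1 uS2 W1U V1V2 S2U S2V2 irr2).
- exact: rank2_iso p0 r1 r2 g1 g2.
- apply: (rank2_not_conj r1 g1 g2) => // UV.
  (* If clock and shift commuted, zeta would be 1, whereas its order is p > 1. *)
  have zeta1 : zeta = 1.
    apply: (@scale_unit_inj _ _ _ _ (U * V1)); first exact: mul_unit.
    by rewrite -W1U -UV scale1r.
  have := eq_prim_root_expr pz 1 0; rewrite expr1 expr0 zeta1 eqxx => /esym.
  by rewrite mod0n modn_small ?prime_gt1.
Qed.

Theorem mainTheorem16 (F : closedFieldType) (charF0 : [pchar F] =i pred0)
  (n : nat) (hn : (2 <= n)%N) :
  (forall H1 H2 : 'M[F]_n -> Prop,
     subgroupPSL H1 -> subgroupPSL H2 ->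
     irreducibleSL H1 -> irreducibleSL H2 ->
     isoPSL (centPSL H1) (centPSL H2) ->
     conjPSL (centPSL H1) (centPSL H2))
  <-> squarefree n.
Proof.
case: n hn => // m _; split=> [conj p pp|sqf H1 H2 [[_ s1 _ _] _] [[_ s2 _ _] _]].
  apply/negP => /(nonsquarefree_counterexample charF0 pp).
  by move=> [H1 [H2 [[g1 g2] [i1 i2] iso]]]; apply; apply: conj.
exact: squarefree_conj.
Qed.
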